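(* Let $H$ be a separable Hilbert space and fix $n>0$. Let $(X_1,\dots,X_n)$ be $H$-valued and $(\epsilon_1,\dots,\epsilon_n)$ real-valued random variables, and $(\mathcal{F}_t)_{t\geq 0}$ a filtration such that for all $t$: $X_t$ is $\mathcal{F}_{t-1}$-measurable, $\epsilon_t$ is $\mathcal{F}_t$-measurable, and $\mathbb{E}[\epsilon_t\mid\mathcal{F}_{t-1}]=0$. Suppose $|\epsilon_i|\le B$ and $\mathrm{Var}(\epsilon_i\mid\mathcal{F}_{i-1})\le\sigma_i^2$ almost surely, with $\sigma_i$ $\mathcal{F}_{i-1}$-measurable. Fix $\rho>0$ and set $V_t=\sum_{i\leq t}X_iX_i^T$, $M_t=\sum_{i\le t}X_i\epsilon_i$, $G_t=(\rho I+V_t)^{-1/2}X_t$. If $\sum_{i\le n}\sigma_i^2\|G_i\|^2\le C_n^2$ almost surely for a deterministic $C_n\ge0$, then for $\delta\in(0,1)$, with probability at least $1-\delta$, $$\sup_{t\le n}\|(\rho I+V_t)^{-1/2}M_t\|\le \frac{C_n^2}{B}\,h^{-1}\Big(\frac{B^2}{C_n^2}\log(2/\delta)\Big),$$ where $h(u)=(1+u)\log(1+u)-u$. Equivalently, for all $r\ge0$, $$\mathbb{P}\Big(\sup_{t\le n}\|(\rho I+V_t)^{-1/2}M_t\|\ge r\Big)\le 2\exp\Big(-\frac{C_n^2}{B^2}h\Big(\frac{Br}{C_n^2}\Big)\Big).$$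
   Context: For $f,g\in H$, $fg^T$ denotes the operator $f\langle g,\cdot\rangle$ on $H$, and $I$ is the identity operator on $H$. *)

(* Defs.v *)
From HB Require Import structures.
From mathcomp Require Import all_boot all_order all_algebra.
From mathcomp Require Import all_classical all_reals all_analysis.
From Stdlib Require Import ClassicalEpsilon.
Set Implicit Arguments. Unset Strict Implicit. Unset Printing Implicit Defensive.
Import Order.TTheory GRing.Theory Num.Theory.
Import numFieldNormedType.Exports.
Local Open Scope classical_set_scope.
Local Open Scope ring_scope.

Definition inner_product {R : realType} {H : normedModType R} (ip : H -> H -> R) :=
  [/\ (forall x y, ip x y = ip y x),
      (forall (a : R) (x y z : H), ip (a *: x + y) z = a * ip x z + ip y z) &
      (forall x, `|x| ^+ 2 = ip x x)].

Definition separable (R : realType) (H : normedModType R) :=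
  exists D : set H, countable D /\ closure D = setT.

Definition inv_sqrt_spec {R : realType} {H : normedModType R}
  (ip : H -> H -> R) (T A : H -> H) :=
  [/\ (forall (a : R) (x y : H), A (a *: x + y) = a *: A x + A y),
      (forall x y, ip (A x) y = ip x (A y)),
      (forall x, 0 <= ip (A x) x),
      (forall x, A (A (T x)) = x) &
      (forall x, T (A (A x)) = x)].

Definition inv_sqrt {R : realType} {H : normedModType R}
  (ip : H -> H -> R) (T : H -> H) : H -> H :=
  epsilon (inhabits id) (inv_sqrt_spec ip T).

Definition filtration {d} {Omega : measurableType d} (F : nat -> set (set Omega)) :=
  forall t, [/\ sigma_algebra setT (F t), F t `<=` measurable & F t `<=` F t.+1].

Definition Rmeas_wrt {d} {Omega : measurableType d} {R : realType}
  (G : set (set Omega)) (f : Omega -> R) :=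
  forall B : set R, measurable B -> G (f @^-1` B).

(* H-valued map measurable w.r.t. G (Borel sets on H, generated by open sets) *)
Definition Hmeas_wrt {d} {Omega : measurableType d} {R : realType} {H : normedModType R}
  (G : set (set Omega)) (f : Omega -> H) :=
  forall U : set H, open U -> G (f @^-1` U).

Definition cond_exp_spec {d} {Omega : measurableType d} {R : realType}
  (P : probability Omega R) (G : set (set Omega)) (Y Z : Omega -> R) :=
  [/\ Rmeas_wrt G Z, P.-integrable setT (EFin \o Z) &
      forall A, G A -> (\int[P]_(w in A) (Y w)%:E = \int[P]_(w in A) (Z w)%:E)%E].

Definition cond_var_le {d} {Omega : measurableType d} {R : realType}
  (P : probability Omega R) (G : set (set Omega)) (Y s : Omega -> R) :=
  exists m, cond_exp_spec P G Y m /\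
  exists v, cond_exp_spec P G (fun w => (Y w - m w) ^+ 2) v /\
            {ae P, forall w, v w <= s w}.

Definition hfun {R : realType} (u : R) : R := (1 + u) * ln (1 + u) - u.

Definition hinv {R : realType} (y : R) : R :=
  epsilon (inhabits 0) (fun u : R => 0 <= u /\ hfun u = y).

(* Main.v *)
Require Import Defs.
From HB Require Import structures.
From mathcomp Require Import all_boot all_order all_algebra.
From mathcomp Require Import all_classical all_reals all_analysis.
From mathcomp Require Import measurable_realfun ring lra complex.
From Stdlib Require Import ClassicalEpsilon.
Set Implicit Arguments. Unset Strict Implicit. Unset Printing Implicit Defensive.
Import Order.TTheory GRing.Theory Num.Theory.
Import numFieldNormedType.Exports.
Local Open Scope classical_set_scope.
Local Open Scope ring_scope.

(** Write [T_t = rho I + V_t] and [Y_t = |T_t^(-1/2) M_t|].  Since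
    [T_t >= T_(t-1)], the vector [a = T_t^(-1/2) M_(t-1)] has norm at most
    [Y_(t-1)], and [T_t^(-1/2) M_t = a + eps_t G_t] with [|G_t| <= 1].  The
    function [cosh (sqrt z)] is convex, which gives Pinelis' inequality
    [cosh |a + x| <= cosh |a| + <a, x> sinh |a| / |a| + cosh |a| (e^|x| - 1 - |x|)].
    Hence [cosh (lam Y_t) exp (- phi sum_(i <= t) sigma_i^2 |G_i|^2)] is a
    supermartingale for [phi = (e^(lam B) - 1 - lam B) / B^2]; stopping it when
    [Y_t] reaches [r] and taking [lam = ln (1 + B r / C^2) / B] gives the tail
    bound.

    The operator [T_t^(-1/2)] exists because a real polynomial annihilates
    [V_t], so that it can be taken to be a polynomial in [V_t].  All scalar
    products [<X_i, T_k^(-1) X_j>] are measurable by the rank-one update formula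
    for [T_k^(-1)], starting from the Gram matrix of the [X_i]. *)

(** Since X_t is predictable, T_t is already known at time t-1. This is why M_(t-1) is measured with
    T_t: given F_(t-1), the vectors a and G_t are fixed, so the inner product term of Pinelis'
    inequality, which is linear in eps_t, integrates to zero. The obstacle is that [inv_sqrt] is
    picked by [epsilon], so nothing is known about how it varies with the outcome. Every norm is
    therefore turned into a quadratic form, |T_t^(-1/2) x|^2 = <x, T_t^(-1) x>, and T_t^(-1) is
    determined by T_t. The martingale argument then sees only four real processes: N_t = |T_t^(-1/2)
    M_t|^2, the same form q_t with M_(t-1) in place of M_t, g_t = |G_t|^2 and b_t = <X_t, T_t^(-1)
    M_(t-1)>, tied by N_t = q_t + 2 eps_t b_t + eps_t^2 g_t. The value of lam minimises phi C^2 -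
    lam r, and the factor 2 is the price of e^x <= 2 cosh x. *)

(** * Algebra of a real inner product *)

Section InnerProduct.
Context {R : realType} {H : normedModType R} (ip : H -> H -> R).
Hypothesis ipP : inner_product ip.

Lemma ipC x y : ip x y = ip y x. Proof. by case: ipP. Qed.

Lemma ip_norm x : ip x x = `|x| ^+ 2. Proof. by case: ipP. Qed.

Lemma ip_ge0 x : 0 <= ip x x. Proof. by rewrite ip_norm sqr_ge0. Qed.

Lemma ip0l x : ip 0 x = 0.
Proof.
case: ipP => _ ipl _; have := ipl 1 0 0 x.
by rewrite scale1r addr0 mul1r => /eqP; rewrite -subr_eq0 opprD addNKr oppr_eq0 => /eqP.
Qed.

Lemma ipDl x y z : ip (x + y) z = ip x z + ip y z.
Proof. by case: ipP => _ ipl _; have := ipl 1 x y z; rewrite scale1r mul1r. Qed.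

Lemma ipZl a x z : ip (a *: x) z = a * ip x z.
Proof. by case: ipP => _ ipl _; have := ipl a x 0 z; rewrite addr0 ip0l addr0. Qed.

Lemma ipDr x y z : ip z (x + y) = ip z x + ip z y.
Proof. by rewrite ipC ipDl !(ipC z). Qed.

Lemma ipZr a x z : ip z (a *: x) = a * ip z x.
Proof. by rewrite ipC ipZl (ipC z). Qed.

Lemma ip0r x : ip x 0 = 0. Proof. by rewrite ipC ip0l. Qed.

Lemma ipNl x z : ip (- x) z = - ip x z.
Proof. by rewrite -scaleN1r ipZl mulN1r. Qed.

Lemma ipNr x z : ip z (- x) = - ip z x.
Proof. by rewrite ipC ipNl (ipC z). Qed.

Lemma ip_suml (I : Type) (r : seq I) (Q : pred I) (f : I -> H) z :
  ip (\sum_(i <- r | Q i) f i) z = \sum_(i <- r | Q i) ip (f i) z.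
Proof. exact: (big_morph (ip^~ z) (fun x y => ipDl x y z) (ip0l z)). Qed.

Lemma ip_sumr (I : Type) (r : seq I) (Q : pred I) (f : I -> H) z :
  ip z (\sum_(i <- r | Q i) f i) = \sum_(i <- r | Q i) ip z (f i).
Proof. by rewrite ipC ip_suml; apply: eq_bigr => i _; rewrite ipC. Qed.

Lemma ip_eq0 x : ip x x = 0 -> x = 0.
Proof. by rewrite ip_norm => /eqP; rewrite sqrf_eq0 normr_eq0 => /eqP. Qed.

Lemma cauchy_schwarz x y : ip x y ^+ 2 <= ip x x * ip y y.
Proof.
have [->|y0] := eqVneq y 0; first by rewrite !ip0r expr0n mulr0.
have yy : 0 < ip y y by rewrite ip_norm exprn_gt0 // normr_gt0.
have := ip_ge0 (ip y y *: x - ip x y *: y).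
rewrite ipDl !ipDr !(ipZl, ipZr, ipNl, ipNr) (ipC y x).
set a := ip x x; set b := ip y y; set c := ip x y => h.
have : 0 <= b * (a * b - c ^+ 2) by move: h; congr (0 <= _); ring.
by rewrite pmulr_rge0 // subr_ge0.
Qed.

End InnerProduct.

(** * Real polynomials: interpolation and factors of degree one or two *)

Section Interpolation.
Context {K : fieldType}.

Lemma interpolation (s : seq K) (f : K -> K) : uniq s ->
  exists q : {poly K}, forall a, a \in s -> q.[a] = f a.
Proof.
elim: s => [_|b s IHs /= /andP[bs us]]; first by exists 0.
have [q qE] := IHs us; pose m : {poly K} := \prod_(z <- s) ('X - z%:P).
have mb : m.[b] != 0 by rewrite -[_ == _]/(root m b) root_prod_XsubC.
(* Newton's correction: [m] vanishes at the earlier nodes, so their values are kept. *)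
exists (q + ((f b - q.[b]) / m.[b]) *: m) => a.
rewrite inE => /orP[/eqP ->|as_]; rewrite hornerD hornerZ.
  by rewrite divfK // addrC subrK.
by rewrite (eqP (_ : root m a)) ?mulr0 ?addr0 ?qE // root_prod_XsubC.
Qed.

End Interpolation.

(** Take a complex root a + ib. If b is nonzero, the remainder of [p] modulo (X - a)^2 + b^2 is real
    of degree at most one and vanishes at a nonreal point, so both of its coefficients are zero. *)
Lemma real_root_or_quadratic_factor (R : realType) (p : {poly R}) :
  (1 < size p)%N ->
  (exists a, root p a) \/
  (exists a b, b != 0 /\ ('X - a%:P) ^+ 2 + (b ^+ 2)%:P %| p).
Proof.
move=> sp; pose c : {rmorphism R -> R[i]%C} := real_complex R.
have [|z rz] := @closed_rootP R[i]%C (map_poly c p) _.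
  by rewrite size_map_poly; case: size sp => [|[]].
pose a := complex.Re z; pose b := complex.Im z; pose i : R[i]%C := Complex 0 1.
have zE : z = c a + i * c b.
  rewrite /a /b /i; case: (z) => u v; congr Complex; rewrite /=; ring.
have i2 : i ^+ 2 = - 1.
  rewrite expr2 /i; congr Complex; rewrite /=; ring.
have [b0|b0] := eqVneq b 0.
  left; exists a; move: rz; rewrite zE b0 rmorph0 mulr0 addr0.
  by rewrite /root horner_map fmorph_eq0.
right; exists a, b; split => //; set d := _ + _.
have dE : d = 'X ^+ 2 - (a + a) *: 'X + (a ^+ 2 + b ^+ 2)%:P.
  rewrite /d -mul_polyC !(polyCD, polyCM) ?expr2 ?polyCM; ring.
have sd : size d = 3%N.
  rewrite dE -addrA size_addl size_polyXn // ltnS.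
  apply: leq_trans (size_add _ _) _; rewrite geq_max size_opp.
  by rewrite (leq_trans (size_scale_leq _ _)) ?size_polyX //= (leq_trans (size_polyC_leq1 _)).
have dz : (map_poly c d).[z] = 0.
  rewrite /d !rmorphD rmorphXn rmorphB /= map_polyX !map_polyC /= !hornerE.
  rewrite zE /= rmorphXn /=.
  rewrite [X in X ^+ 2](_ : _ = i * c b); last by rewrite /=; ring.
  by rewrite exprMn i2 mulN1r addNr.
pose r := p %% d.
have sr : (size r < 3)%N by rewrite -sd ltn_modp -size_poly_eq0 sd.
have rr : (map_poly c r).[z] = 0.
  have := divp_eq p d => /(congr1 (fun q => (map_poly c q).[z])).
  by rewrite rmorphD rmorphM /= hornerD hornerM dz mulr0 add0r -/r (eqP rz).
have rE : r = r`_1 *: 'X + (r`_0)%:P.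
  apply/polyP => -[|[|k]]; rewrite coefD coefZ coefX coefC /= ?(mulr0, mulr1, addr0, add0r) //.
  by apply: nth_default; apply: (@leq_trans 2).
move: rr; rewrite rE rmorphD /= linearZ /= map_polyX map_polyC /= !hornerE zE => rr.
have r1 : r`_1 = 0.
  have := congr1 (@complex.Im R) rr.
  rewrite /= !(mul0r, mulr0, mul1r, add0r, addr0, subr0) => /eqP.
  by rewrite mulf_eq0 (negbTE b0) orbF => /eqP.
have r0 : r`_0 = 0.
  by move/eqP: rr; rewrite r1 rmorph0 mul0r add0r fmorph_eq0 => /eqP.
by rewrite /dvdp -/r rE r1 r0 scale0r addr0.
Qed.

(** * Polynomials in a symmetric nonnegative operator, and its inverse square root *)

Section FunctionalCalculus.
Context {R : realType} {H : normedModType R} (ip : H -> H -> R) (V : H -> H).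
Hypothesis ipP : inner_product ip.
Hypothesis V_linear : forall (a : R) x y, V (a *: x + y) = a *: V x + V y.
Hypothesis V_sym : forall x y, ip (V x) y = ip x (V y).

Definition peval (p : {poly R}) (x : H) : H :=
  \sum_(i < size p) p`_i *: iter i V x.

Lemma peval_wide m (p : {poly R}) x : (size p <= m)%N ->
  peval p x = \sum_(i < m) p`_i *: iter i V x.
Proof.
move=> pm; rewrite /peval (big_ord_widen m (fun i => p`_i *: iter i V x)) //.
rewrite big_mkcond; apply: eq_bigr => i _; case: ltnP => // si.
by rewrite nth_default // scale0r.
Qed.

Lemma iter_linear k (a : R) x y :
  iter k V (a *: x + y) = a *: iter k V x + iter k V y.
Proof. by elim: k => //= k ->; rewrite V_linear. Qed.

Lemma iter_sym k x y : ip (iter k V x) y = ip x (iter k V y).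
Proof. by elim: k x y => //= k IH x y; rewrite V_sym IH -iterSr. Qed.

Lemma peval_linear p (a : R) x y :
  peval p (a *: x + y) = a *: peval p x + peval p y.
Proof.
rewrite /peval scaler_sumr -big_split; apply: eq_bigr => i _ /=.
by rewrite iter_linear scalerDr !scalerA mulrC.
Qed.

Lemma peval_additive p : {morph peval p : x y / x + y}.
Proof. by move=> x y; have := peval_linear p 1 x y; rewrite !scale1r. Qed.

Lemma pevalr0 p : peval p 0 = 0.
Proof. by apply: (addIr (peval p 0)); rewrite -peval_additive !add0r. Qed.

Lemma peval_sym p x y : ip (peval p x) y = ip x (peval p y).
Proof.
rewrite /peval ip_suml // ip_sumr //; apply: eq_bigr => i _.
by rewrite ipZl // ipZr // iter_sym.
Qed.

Lemma pevalD p q x : peval (p + q) x = peval p x + peval q x.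
Proof.
pose m := maxn (size p) (size q).
rewrite !(@peval_wide m) ?leq_maxl ?leq_maxr ?size_add // -big_split.
by apply: eq_bigr => i _ /=; rewrite coefD scalerDl.
Qed.

Lemma pevalZ (a : R) p x : peval (a *: p) x = a *: peval p x.
Proof.
rewrite (@peval_wide (size p)) ?size_scale_leq // scaler_sumr.
by apply: eq_bigr => i _; rewrite coefZ scalerA.
Qed.

Lemma peval0 x : peval 0 x = 0.
Proof. by rewrite /peval size_poly0 big_ord0. Qed.

Lemma pevalC (a : R) x : peval a%:P x = a *: x.
Proof.
by rewrite (@peval_wide 1) ?size_polyC_leq1 // big_ord_recl big_ord0 addr0 coefC.
Qed.

Lemma pevalMX p x : peval (p * 'X) x = peval p (V x).
Proof.
rewrite (@peval_wide (size p).+1); last first.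
  by rewrite (leq_trans (size_mul_leq _ _)) // size_polyX addn2.
rewrite big_ord_recl coefMX /= scale0r add0r; apply: eq_bigr => i _.
by rewrite coefMX /= -iterSr.
Qed.

Lemma peval_comm p x : peval p (V x) = V (peval p x).
Proof.
have -> : V (peval p x) = iter 1 V (peval p x) by [].
rewrite /peval (big_morph (iter 1 V) (id1 := 0) (op1 := +%R)); last 2 first.
- by move=> y z; have := iter_linear 1 1 y z; rewrite !scale1r.
- apply: (addIr (iter 1 V 0)); rewrite add0r.
  by have := iter_linear 1 1 0 0; rewrite !scale1r addr0.
apply: eq_bigr => i _; rewrite -iterSr /=.
have := iter_linear 1 p`_i (iter i V x) 0 => /=; rewrite addr0 => ->.
have -> : V 0 = 0 by have := V_linear (-1) 0 0; rewrite scaler0 addr0 scaleN1r addNr.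
by rewrite addr0.
Qed.

Lemma pevalX x : peval 'X x = V x.
Proof. by rewrite -[X in peval X _]mul1r pevalMX -[1]/(1%:P) pevalC scale1r. Qed.

Lemma pevalM p q x : peval (p * q) x = peval p (peval q x).
Proof.
elim/poly_ind: p q x => [|p c IHp] q x; first by rewrite mul0r !peval0.
rewrite mulrDl pevalD -mulrA (mulrC 'X) IHp mul_polyC pevalZ.
by rewrite [RHS]pevalD !pevalMX pevalC peval_comm.
Qed.

Hypothesis V_ge0 : forall x, 0 <= ip (V x) x.

(** Pairing with x gives |(V - a) x|^2 + b^2 |x|^2 = 0. *)
Lemma quadratic_inj (a b : R) x : b != 0 ->
  peval (('X - a%:P) ^+ 2 + (b ^+ 2)%:P) x = 0 -> x = 0.
Proof.
move=> b0; rewrite pevalD expr2 pevalM pevalC => /(congr1 (ip^~ x)).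
rewrite ip0l // ipDl // ipZl // peval_sym => h; apply: (ip_eq0 ipP).
apply/eqP; rewrite eq_le ip_ge0 // andbT.
rewrite -(@pmulr_rle0 _ (b ^+ 2)) ?exprn_even_gt0 //.
by rewrite -h lerDr ip_ge0.
Qed.

(** Pairing with x gives <V x, x> + (- a) |x|^2 = 0, a sum of nonnegative terms. *)
Lemma negative_inj (a : R) x : a < 0 -> peval ('X - a%:P) x = 0 -> x = 0.
Proof.
move=> a0; rewrite -polyCN pevalD pevalC pevalX => /(congr1 (ip^~ x)).
rewrite ip0l // ipDl // ipZl // => h; apply: (ip_eq0 ipP).
apply/eqP; rewrite eq_le ip_ge0 // andbT -(@pmulr_rle0 _ (- a)) ?oppr_gt0 //.
by rewrite -h lerDr.
Qed.

(** By symmetry |p(V) x|^2 = <x, p(V)^2 x>. *)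
Lemma square_ker p x : peval (p * p) x = 0 -> peval p x = 0.
Proof.
by rewrite pevalM => h; apply: (ip_eq0 ipP); rewrite peval_sym h ip0r.
Qed.

(* Roots are stripped one at a time: since the operator is symmetric and
   nonnegative, the factors of nonreal and of negative roots are injective, and
   repeated factors have the same kernel as simple ones. *)
Lemma split_annihilator (p : {poly R}) : p != 0 -> (forall x, peval p x = 0) ->
  exists s : seq R, [/\ uniq s, all (>= 0) s &
    forall x, peval (\prod_(a <- s) ('X - a%:P)) x = 0].
Proof.
move=> p0 pV.
(* [s] collects the distinct nonnegative roots found so far, [q] is the part still to be factored,
   and [k] bounds its size. *)
suff gen k (q : {poly R}) (s : seq R) : (size q <= k)%N -> q != 0 -> uniq s ->
    all (>= 0) s -> (forall x, peval (q * \prod_(a <- s) ('X - a%:P)) x = 0) ->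
    exists s : seq R, [/\ uniq s, all (>= 0) s &
      forall x, peval (\prod_(a <- s) ('X - a%:P)) x = 0].
  by apply: (gen (size p) p [::]) => // x; rewrite big_nil mulr1.
elim: k q s => [|k IHk] q s qk q0 us s_ge0 qV.
  by move: qk q0; rewrite leqn0 size_poly_eq0 => /eqP ->; rewrite eqxx.
have [sq|sq] := leqP (size q) 1.
  exists s; split => // x; have qC := size1_polyC sq.
  move: (qV x) q0; rewrite qC mul_polyC pevalZ polyC_eq0 => /eqP.
  by rewrite scaler_eq0 => /orP[->|/eqP].
set m := \prod_(a <- s) _ in qV.
have step (e q' : {poly R}) : q = q' * e -> (1 < size e)%N ->
    (size q' <= k)%N /\ q' != 0.
  move=> qE se; have e0 : e != 0 by rewrite -size_poly_gt0 (ltn_trans _ se).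
  have q'0 : q' != 0 by apply: contraNneq q0 => q'0; rewrite qE q'0 mul0r.
  split => //; rewrite -ltnS (leq_trans _ qk) // qE size_mul //.
  by case: size se => [|[|j]] // _; rewrite !addnS /= ltnS leq_addr.
have [[a /factor_theorem[q' qE]]|[a [b [b0 /dvdpP[q' qE]]]]] :=
    real_root_or_quadratic_factor sq; last first.
  have sd : (1 < size (('X - a%:P) ^+ 2 + (b ^+ 2)%:P)%R)%N.
    rewrite size_addl size_exp_XsubC // (leq_ltn_trans (size_polyC_leq1 _)) //.
  have [q'k q'0] := step _ _ qE sd.
  apply: (IHk q' s) => // x; apply: (quadratic_inj (a := a) b0).
  by rewrite -pevalM mulrA (mulrC _ q') -qE.
have sX : (1 < size ('X - a%:P)%R)%N by rewrite size_XsubC.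
have [q'k q'0] := step _ _ qE sX.
have [a0|a0] := ltP a 0.
  apply: (IHk q' s) => // x; apply: (negative_inj a0).
  by rewrite -pevalM mulrA (mulrC _ q') -qE.
have [as_|as_] := boolP (a \in s); last first.
  apply: (IHk q' (a :: s)) => //=; rewrite ?as_ ?a0 // => x.
  by rewrite big_cons mulrA -qE.
apply: (IHk q' s) => // x.
have mE : m = (\prod_(z <- rem a s) ('X - z%:P)) * ('X - a%:P).
  by rewrite /m (perm_big _ (perm_to_rem as_)) big_cons mulrC.
set m' := \prod_(z <- rem a s) _ in mE.
(* The root [a] now occurs twice. Multiplied by [q' * m'], the annihilator becomes the square of
   [q' * m]. *)
have := qV (peval (q' * m') x); rewrite -pevalM qE mE => h.
rewrite -/m mE mulrA; apply: square_ker.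
by move: h; congr (peval _ _ = 0); ring.
Qed.

(** Once V is annihilated by a product of distinct factors X - a, a polynomial in V depends only on
    its values at these points a. So functions of V can be built by interpolation. *)
Lemma inv_sqrt_of_annihilator (rho : R) (p : {poly R}) : 0 < rho ->
  p != 0 -> (forall x, peval p x = 0) ->
  exists A, inv_sqrt_spec ip (fun x => rho *: x + V x) A.
Proof.
move=> rho0 p0 pV; have [s [us s_ge0 sV]] := split_annihilator p0 pV.
(* The fourth root is interpolated, not the square root: the operator will be q(V)^2, which is
   nonnegative as the square of a symmetric operator. *)
pose f a := (Num.sqrt (Num.sqrt (rho + a)))^-1.
have [q qE] := interpolation f us.
(* [r] vanishes at every point of [s], so r(V) = 0, that is q(V)^4 (rho I + V) = I. *)
pose r := q ^+ 4 * (rho%:P + 'X) - 1.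
have rV x : peval r x = 0.
  have /dvdpP[r' ->] : \prod_(z <- s) ('X - z%:P) %| r.
    apply: uniq_roots_dvdp; last by rewrite uniq_rootsE.
    apply/allP => a as_; have a0 : 0 < rho + a.
      by rewrite ltr_pwDl //; exact: (allP s_ge0).
    rewrite /root /r !hornerE qE // /f exprVn (exprM _ 2 2) sqr_sqrtr ?sqrtr_ge0 //.
    by rewrite sqr_sqrtr ?ltW // mulVf ?subrr // gt_eqF.
  by rewrite pevalM sV pevalr0.
have TE x : rho *: x + V x = peval (rho%:P + 'X) x by rewrite pevalD pevalC pevalX.
have r1 x : peval (q ^+ 4 * (rho%:P + 'X)) x = x.
  apply/eqP; rewrite -subr_eq0; have := rV x.
  by rewrite /r -[- 1]/(- 1%:P) -polyCN pevalD pevalC scaleN1r => ->.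
exists (peval (q ^+ 2)); split.
- exact: peval_linear.
- exact: peval_sym.
- by move=> x; rewrite expr2 pevalM peval_sym ip_ge0.
- by move=> x; rewrite TE -!pevalM -[RHS]r1; congr (peval _ _); ring.
- by move=> x; rewrite TE -!pevalM -[RHS]r1; congr (peval _ _); ring.
Qed.

End FunctionalCalculus.

(** * The operators V_t, T_t = rho I + V_t and T_t^(-1), and how they change with t *)

Section GramOperator.
Context {R : realType} {H : normedModType R} (ip : H -> H -> R) (X : nat -> H).
Hypothesis ipP : inner_product ip.

Definition gramop (t : nat) (x : H) : H :=
  \sum_(1 <= i < t.+1) ip (X i) x *: X i.

Lemma gramop0 x : gramop 0 x = 0.
Proof. by rewrite /gramop big_geq. Qed.

Lemma gramopS t x : gramop t.+1 x = gramop t x + ip (X t.+1) x *: X t.+1.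
Proof. by rewrite /gramop big_nat_recr. Qed.

Lemma gramop_linear t (a : R) x y :
  gramop t (a *: x + y) = a *: gramop t x + gramop t y.
Proof.
rewrite /gramop scaler_sumr -big_split; apply: eq_bigr => i _ /=.
by rewrite ipDr // ipZr // scalerDl scalerA.
Qed.

Lemma ip_gramop t x y :
  ip (gramop t x) y = \sum_(1 <= i < t.+1) ip (X i) x * ip (X i) y.
Proof. by rewrite /gramop ip_suml //; apply: eq_bigr => i _; rewrite ipZl. Qed.

Lemma gramop_sym t x y : ip (gramop t x) y = ip x (gramop t y).
Proof.
rewrite (ipC ipP x) !ip_gramop; apply: eq_bigr => i _; exact: mulrC.
Qed.

Lemma gramop_ge0 t x : 0 <= ip (gramop t x) x.
Proof. by rewrite ip_gramop sumr_ge0 // => i _; rewrite -expr2 sqr_ge0. Qed.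

(** On combinations of the X_i, which may be linearly dependent, V_t acts on coefficient vectors as
    the Gram matrix [K], so Cayley-Hamilton applies. The extra factor X first maps an arbitrary x to
    such a combination. *)
Lemma gramop_annihilator t :
  exists2 p : {poly R}, p != 0 & forall x, peval (gramop t) p x = 0.
Proof.
have gl := @gramop_linear; case: t => [|t].
  by exists 'X => [|x]; rewrite ?polyX_eq0 // pevalX gramop0.
pose K := \matrix_(i < t.+1, j < t.+1) ip (X i.+1) (X j.+1).
pose comb (u : 'cV[R]_t.+1) := \sum_(i < t.+1) u i 0 *: X i.+1.
have gramE x : gramop t.+1 x = comb (\col_i ip (X i.+1) x).
  by rewrite /gramop big_add1 big_mkord; apply: eq_bigr => i _; rewrite mxE.
have gram_comb u : gramop t.+1 (comb u) = comb (K *m u).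
  rewrite gramE; congr comb; apply/colP => i; rewrite !mxE ip_sumr //.
  by apply: eq_bigr => j _; rewrite ipZr // mxE mulrC.
have peval_comb p u : peval (gramop t.+1) p (comb u) = comb (horner_mx K p *m u).
  elim/poly_ind: p u => [|p c IHp] u.
    rewrite peval0 rmorph0 mul0mx /comb big1 // => i _; by rewrite mxE scale0r.
  rewrite pevalD pevalMX pevalC gram_comb IHp rmorphD rmorphM /=.
  rewrite horner_mx_X horner_mx_C mulmxDl mul_scalar_mx -mulmxA.
  rewrite /comb scaler_sumr -big_split; apply: eq_bigr => i _ /=.
  by rewrite !mxE scalerDl scalerA.
exists (char_poly K * 'X) => [|x].
  by rewrite mulf_neq0 ?polyX_eq0 // monic_neq0 // char_poly_monic.
rewrite pevalMX gramE peval_comb Cayley_Hamilton mul0mx /comb big1 // => i _.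
by rewrite mxE scale0r.
Qed.

Context (rho : R).
Hypothesis rho_gt0 : 0 < rho.

Definition shifted_gramop (t : nat) (x : H) : H := rho *: x + gramop t x.

Definition gram_inv_sqrt (t : nat) : H -> H := inv_sqrt ip (shifted_gramop t).

(** This is T_t^(-1). By [shiftedK] and [gram_invK] it is the two-sided inverse of T_t, whichever
    square root [epsilon] picks. *)
Definition gram_inv (t : nat) (x : H) : H := gram_inv_sqrt t (gram_inv_sqrt t x).

Local Notation T := shifted_gramop.
Local Notation A := gram_inv_sqrt.
Local Notation J := gram_inv.

Lemma gram_inv_sqrtP t : inv_sqrt_spec ip (T t) (A t).
Proof.
apply: epsilon_spec; have [p p0 pV] := gramop_annihilator t.
exact: (inv_sqrt_of_annihilator ipP (@gramop_linear t) (@gramop_sym t)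
          (@gramop_ge0 t) rho_gt0 p0 pV).
Qed.

Lemma shiftedK t : cancel (T t) (J t).
Proof. by case: (gram_inv_sqrtP t). Qed.

Lemma gram_invK t : cancel (J t) (T t).
Proof. by case: (gram_inv_sqrtP t). Qed.

Lemma norm_gram_inv_sqrt t x : `|A t x| ^+ 2 = ip x (J t x).
Proof. by case: (gram_inv_sqrtP t) => _ symA _ _ _; rewrite -(ip_norm ipP) symA. Qed.

Lemma gram_inv_sym t x y : ip (J t x) y = ip x (J t y).
Proof. by case: (gram_inv_sqrtP t) => _ symA _ _ _; rewrite /J !symA. Qed.

Lemma gram_inv_linear t (a : R) x y : J t (a *: x + y) = a *: J t x + J t y.
Proof. by case: (gram_inv_sqrtP t) => linA _ _ _ _; rewrite /J !linA. Qed.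

Lemma gram_invD t x y : J t (x + y) = J t x + J t y.
Proof. by have := gram_inv_linear t 1 x y; rewrite !scale1r. Qed.

Lemma gram_inv0 t : J t 0 = 0.
Proof. by apply: (addIr (J t 0)); rewrite -gram_invD !add0r. Qed.

Lemma gram_invZ t (a : R) x : J t (a *: x) = a *: J t x.
Proof. by have := gram_inv_linear t a x 0; rewrite gram_inv0 !addr0. Qed.

Lemma gram_inv_ge0 t x : 0 <= ip x (J t x).
Proof. by rewrite -norm_gram_inv_sqrt sqr_ge0. Qed.

Lemma gram_inv_cauchy_schwarz t x y :
  ip x (J t y) ^+ 2 <= ip y (J t y) * ip x (J t x).
Proof.
have [_ symA _ _ _] := gram_inv_sqrtP t.
have JE u v : ip u (J t v) = ip (A t u) (A t v) by rewrite symA.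
by rewrite !JE mulrC; exact: cauchy_schwarz.
Qed.

Lemma ip_shifted t x y : ip x (T t y) =
  rho * ip x y + \sum_(1 <= i < t.+1) ip (X i) x * ip (X i) y.
Proof.
rewrite /T ipDr // ipZr // (ipC ipP x (gramop _ _)) ip_gramop.
by congr (_ + _); apply: eq_bigr => i _; exact: mulrC.
Qed.

Lemma shiftedS t x : T t.+1 x = T t x + ip (X t.+1) x *: X t.+1.
Proof. by rewrite /T gramopS addrA. Qed.

Lemma shifted_linear t (a : R) x y : T t (a *: x + y) = a *: T t x + T t y.
Proof.
by rewrite /T gramop_linear !scalerDr !scalerA (mulrC rho) addrACA.
Qed.

Lemma shifted_sym t x y : ip (T t x) y = ip x (T t y).
Proof.
rewrite (ipC ipP) !ip_shifted (ipC ipP y x); congr (_ + _).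
by apply: eq_bigr => i _; exact: mulrC.
Qed.

(** With z = T_(t+1)^(-1) X_(t+1), the number g = <z, T_(t+1) z> contains the summand <X_(t+1), z>^2
    = g^2, the others being nonnegative. So g^2 <= g. *)
Lemma gram_inv_le1 t : ip (X t.+1) (J t.+1 (X t.+1)) <= 1.
Proof.
set z := J t.+1 (X t.+1); set g := ip _ _.
have : ip z (T t.+1 z) = g by rewrite gram_invK ipC.
rewrite shiftedS ipDr // ipZr // (ipC ipP z (X _)) -/g => h.
have gg : g * g <= g.
  rewrite -[leRHS]h lerDr ip_shifted addr_ge0 //.
    by rewrite mulr_ge0 ?ip_ge0 // ltW.
  by apply: sumr_ge0 => i _; rewrite -expr2 sqr_ge0.
have [//|g1] := leP g 1.
by move: gg g1; clear; move: g => g gg g1; nra.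
Qed.

Lemma shifted_ge0 t x : 0 <= ip x (T t x).
Proof.
rewrite ip_shifted; apply: addr_ge0.
  by rewrite mulr_ge0 ?(ip_ge0 ipP) // ltW.
by apply: sumr_ge0 => i _; rewrite -expr2 sqr_ge0.
Qed.

(** Put y = T_t^(-1) m, z = T_(t+1)^(-1) m and u = <X_(t+1), z>. Then T_t (y - z) = u X_(t+1), so 0
    <= <y - z, T_t (y - z)> = u <X_(t+1), y> - u^2, while the gap between the two sides is u
    <X_(t+1), y>. *)
Lemma gram_inv_decr t m : ip m (J t.+1 m) <= ip m (J t m).
Proof.
set z := J t.+1 m; set y := J t m.
have yE : T t y = m by rewrite /y gram_invK.
have zE : T t z = m - ip (X t.+1) z *: X t.+1.
  by apply/eqP; rewrite eq_sym subr_eq -shiftedS /z gram_invK.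
set u := ip _ z in zE.
have gap : ip m y - ip m z = u * ip (X t.+1) y.
  have := shifted_sym t z y; rewrite yE zE ipDl // ipNl // ipZl // (ipC ipP z).
  by move=> /eqP; rewrite subr_eq => /eqP ->; rewrite addrC addKr.
have := shifted_ge0 t (- 1 *: z + y).
rewrite shifted_linear yE zE !scaleN1r opprB subrK ipZr // ipDl // ipNl //.
rewrite (ipC ipP z) (ipC ipP y) -/u mulrDr -gap mulrN -expr2 => h.
by rewrite -subr_ge0 (le_trans _ (_ : u ^+ 2 <= _)) ?sqr_ge0 // -subr_ge0 addrC.
Qed.

(** Sherman-Morrison formula, checked by applying T_(t+1) to the right-hand side. *)
Lemma gram_inv_rank1 t x : J t.+1 x = J t x -
  (ip (X t.+1) (J t x) / (1 + ip (X t.+1) (J t (X t.+1)))) *: J t (X t.+1).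
Proof.
set w := ip (X t.+1) (J t (X t.+1)).
have w0 : 1 + w != 0 by rewrite gt_eqF // ltr_pwDl // gram_inv_ge0.
rewrite -[RHS](@shiftedK t.+1); congr (J _ _).
rewrite addrC -scaleNr shifted_linear !shiftedS !gram_invK -/w.
rewrite -[X in X + w *: _]scale1r -scalerDl scalerA mulNr divfK //.
by rewrite scaleNr addrC addrK.
Qed.

Lemma gram_inv_init x : J 0 x = rho^-1 *: x.
Proof.
rewrite -[RHS](@shiftedK 0) /T gramop0 addr0 scalerA divff ?scale1r //.
by rewrite gt_eqF.
Qed.

End GramOperator.

(** * Inequalities for exp, cosh and sinh by comparing power series *)

Section Exponential.
Context {R : realType}.
Implicit Types (x y s p : R).

(** As e^x - 1 - x is the sum of x^k / k! over k >= 2, the inequality holds degree by degree. It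
    reduces the estimates below to inequalities between powers; [l] lists pairs (weight, point). *)
Lemma exp_remainder_comb_ge0 (l : seq (R * R)) :
  (forall k, (1 < k)%N -> 0 <= \sum_(ax <- l) ax.1 * ax.2 ^+ k) ->
  0 <= \sum_(ax <- l) ax.1 * (expR ax.2 - 1 - ax.2).
Proof.
move=> l_ge0.
pose u n := \sum_(ax <- l) ax.1 * (series (exp_coeff ax.2) n - 1 - ax.2).
have u_cvg : u n @[n --> \oo] --> \sum_(ax <- l) ax.1 * (expR ax.2 - 1 - ax.2).
  apply: cvg_big => [|ax _]; first exact: add_continuous.
  apply: cvgMr; apply: cvgB; last exact: cvg_cst.
  by apply: cvgB; [exact: is_cvg_series_exp_coeff|exact: cvg_cst].
apply: (cvgr_to_ge u_cvg); exists 2%N => // n /= n2.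
have -> : u n = \sum_(2 <= k < n) (\sum_(ax <- l) ax.1 * ax.2 ^+ k) / k`!%:R.
  rewrite /u; under [RHS]eq_bigr do rewrite mulr_suml.
  rewrite [RHS]exchange_big /=; apply: eq_bigr => ax _.
  rewrite /series /= (big_cat_nat (n := 2)) //= big_nat_recl // big_nat1.
  rewrite [X in _ * X](_ : _ = \sum_(2 <= k < n) exp_coeff ax.2 k).
    by rewrite mulr_sumr; apply: eq_bigr => k _; rewrite mulrA.
  by rewrite /exp_coeff /= !fact0 (factS 0) expr0 expr1 !divr1; ring.
rewrite big_nat_cond sumr_ge0 // => k; rewrite andbT => /andP[k2 _].
by rewrite divr_ge0 // l_ge0.
Qed.

Definition cosh x : R := (expR x + expR (- x)) / 2.
Definition sinh x : R := (expR x - expR (- x)) / 2.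

Lemma cosh0 : cosh 0 = 1.
Proof. by rewrite /cosh oppr0 expR0; lra. Qed.

Lemma cosh_gt0 x : 0 < cosh x.
Proof. by rewrite divr_gt0 // addr_gt0 ?expR_gt0. Qed.

Lemma expR_le_cosh x : expR x <= 2 * cosh x.
Proof. by rewrite /cosh; have := expR_gt0 (- x); lra. Qed.

Lemma expR_sub1_sub_ge0 x : 0 <= expR x - 1 - x.
Proof. by have := expR_ge1Dx x; lra. Qed.

(** Degree by degree: (t x)^k <= t^2 x^k for k >= 2. In other words (e^y - 1 - y) / y^2 is
    nondecreasing for y > 0. *)
Lemma exp_remainder_scale (t x : R) : 0 <= t <= 1 -> 0 <= x ->
  expR (t * x) - 1 - t * x <= t ^+ 2 * (expR x - 1 - x).
Proof.
move=> /andP[t0 t1] x0.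
have := @exp_remainder_comb_ge0 [:: (t ^+ 2, x); (- 1, t * x)].
rewrite !big_cons !big_nil /= => h; rewrite -subr_ge0.
suff : 0 <= t ^+ 2 * (expR x - 1 - x) + (- 1 * (expR (t * x) - 1 - t * x) + 0) by lra.
apply: h => k k1; rewrite !big_cons big_nil /= addr0 mulN1r subr_ge0 exprMn.
by rewrite ler_wpM2r ?exprn_ge0 // ler_wiXn2l.
Qed.

Lemma sinh_ge x : 0 <= x -> x <= sinh x.
Proof.
move=> x0; have := @exp_remainder_comb_ge0 [:: (1, x); (- 1, - x)].
rewrite !big_cons !big_nil /= => h; rewrite /sinh.
suff : 0 <= 1 * (expR x - 1 - x) + (- 1 * (expR (- x) - 1 - - x) + 0) by lra.
apply: h => k _; rewrite !big_cons big_nil /= addr0 mul1r mulN1r exprNn subr_ge0.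
rewrite -[leRHS]mul1r ler_wpM2r ?exprn_ge0 //.
by rewrite -signr_odd; case: (odd k); rewrite ?expr0 ?expr1; lra.
Qed.

(** Induction on k; the defect in each step is th (1 - th) (u - v) (u^k - v^k), which is
    nonnegative. *)
Lemma convex_expr (th u v : R) k : 0 <= th <= 1 -> 0 <= u -> 0 <= v ->
  (th * u + (1 - th) * v) ^+ k <= th * u ^+ k + (1 - th) * v ^+ k.
Proof.
move=> /andP[th0 th1] u0 v0; elim: k => [|k IHk]; first by rewrite !expr0; lra.
have z0 : 0 <= th * u + (1 - th) * v by nra.
rewrite exprS; apply: le_trans (ler_wpM2l z0 IHk) _; rewrite !exprS.
have mono : 0 <= (u - v) * (u ^+ k - v ^+ k).
  have [uv|vu] := leP u v.
    by rewrite mulr_le0 // subr_le0 ?lerXn2r ?nnegrE.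
  by rewrite mulr_ge0 // subr_ge0 ?lerXn2r ?nnegrE // ltW.
have : 0 <= th * (1 - th) * ((u - v) * (u ^+ k - v ^+ k)).
  by apply: mulr_ge0 mono; apply: mulr_ge0; lra.
by move: (u ^+ k) (v ^+ k) => a b; lra.
Qed.

(* [cosh (sqrt z)] is a power series in [z] with nonnegative coefficients. *)
Lemma cosh_convex (th u v p : R) : 0 <= th <= 1 ->
  p ^+ 2 = th * u ^+ 2 + (1 - th) * v ^+ 2 ->
  cosh p <= th * cosh u + (1 - th) * cosh v.
Proof.
move=> th01 pE.
(* Each point comes with its opposite: odd powers cancel, and even ones reduce to convexity of z^j
   at z = u^2 and z = v^2. The terms -1 - x of the remainders cancel in total. *)
have := @exp_remainder_comb_ge0 [:: (th, u); (th, - u); (1 - th, v);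
  (1 - th, - v); (- 1, p); (- 1, - p)].
rewrite !big_cons !big_nil /= => h; rewrite /cosh.
set S := (X in 0 <= X) in h.
have SE : S = 2 * (th * ((expR u + expR (- u)) / 2) +
   (1 - th) * ((expR v + expR (- v)) / 2) - (expR p + expR (- p)) / 2).
  by rewrite /S; field.
suff : 0 <= S by rewrite SE; lra.
apply: h => k _; rewrite !big_cons big_nil /=.
have evenE z : (- z) ^+ k = (-1) ^+ odd k * z ^+ k by rewrite exprNn signr_odd.
rewrite !evenE; case ok: (odd k); rewrite ?expr0 ?expr1.
  by rewrite le_eqVlt; apply/orP; left; apply/eqP; ring.
have kE : k = (2 * k./2)%N by rewrite mul2n -[LHS]odd_double_half ok.
rewrite kE !exprM pE.
have := @convex_expr th (u ^+ 2) (v ^+ 2) k./2 th01 (sqr_ge0 _) (sqr_ge0 _).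
by move: (_ ^+ k./2) (_ ^+ k./2) (_ ^+ k./2) => a b e; lra.
Qed.

Lemma cosh_ge1 x : 1 <= cosh x.
Proof.
by have := expR_ge1Dx x; have := expR_ge1Dx (- x); rewrite /cosh; lra.
Qed.

(** By convexity: s^2 is the mean of x^2 and 0 with weight (s / x)^2 on x^2, and cosh 0 <= cosh
    x. *)
Lemma ler_cosh s x : 0 <= s <= x -> cosh s <= cosh x.
Proof.
move=> /andP[s0 sx]; have [x0|x0] := eqVneq x 0.
  by have -> : s = x by lra.
have xgt : 0 < x by rewrite lt_neqAle eq_sym x0 (le_trans s0).
have t01 : 0 <= (s / x) ^+ 2 <= 1.
  rewrite sqr_ge0 /= expr_le1 // ?divr_ge0 // ?(le_trans s0) //.
  by rewrite ler_pdivrMr // mul1r.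
apply: le_trans (@cosh_convex _ x 0 s t01 _) _.
  by rewrite expr0n mulr0 addr0 expr_div_n divfK // expf_neq0.
by rewrite cosh0; have := cosh_ge1 x; move: (cosh x) => c; nra.
Qed.

(* Chord of the convex function [cosh (sqrt z)] over [(s - y)^2, (s + y)^2]. *)
Lemma cosh_step s y (c : R) p : 0 <= s -> 0 <= y -> `|c| <= s * y ->
  p ^+ 2 = s ^+ 2 + 2 * c + y ^+ 2 ->
  cosh p <= cosh s + c * (sinh s / s) + cosh s * (expR y - 1 - y).
Proof.
(* [k] is the cosine of the angle between the two vectors; p^2 is then the mean of (s + y)^2 and (s
   - y)^2 with weights (1 + k) / 2 and (1 - k) / 2. *)
move=> s0 y0 csy pE; pose k := c / (s * y).
have kc : k * (s * y) = c.
  rewrite /k; have [sy0|sy0] := eqVneq (s * y) 0; last by rewrite divfK.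
  by apply/eqP; rewrite sy0 mulr0 eq_sym -normr_le0 -sy0.
have k1 : `|k| <= 1.
  rewrite /k; have [sy0|sy0] := eqVneq (s * y) 0.
    by rewrite sy0 invr0 mulr0 normr0.
  rewrite normrM normfV (ger0_norm (mulr_ge0 s0 y0)) ler_pdivrMr ?mul1r //.
  by rewrite lt_neqAle eq_sym sy0 mulr_ge0.
move: k1; rewrite ler_norml => /andP[k1 k2].
have th01 : 0 <= (1 + k) / 2 <= 1 by apply/andP; split; lra.
have := @cosh_convex _ (s + y) (s - y) p th01.
have -> : p ^+ 2 = (1 + k) / 2 * (s + y) ^+ 2 + (1 - (1 + k) / 2) * (s - y) ^+ 2.
  by rewrite pE -kc; field.
move=> /(_ erefl) h; apply: le_trans h _.
(* At s = 0 the quotient is 0 by the convention on inverses, and c is 0 too. *)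
have cE : c * (sinh s / s) = k * y * sinh s.
  rewrite -kc; have [->|s_neq0] := eqVneq s 0.
    by rewrite /sinh oppr0 subrr !mul0r !mulr0.
  by field.
have h1 := sinh_ge s0; have h2 := sinh_ge y0.
have chord : (1 + k) / 2 * cosh (s + y) + (1 - (1 + k) / 2) * cosh (s - y) =
    cosh s * cosh y + k * sinh s * sinh y.
  by rewrite /cosh /sinh opprB opprD !expRD; field.
have yE : expR y = cosh y + sinh y by rewrite /cosh /sinh; field.
have sc : sinh s <= cosh s by rewrite /sinh /cosh; have := expR_gt0 (- s); lra.
rewrite chord cE yE.
(* This product is exactly the claimed bound minus the chord. *)
have : 0 <= (cosh s - k * sinh s) * (sinh y - y).
  rewrite mulr_ge0 ?subr_ge0 //; apply: le_trans sc.
  by rewrite -[leRHS]mul1r ler_wpM2r // (le_trans s0).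
by move: (cosh s) (sinh s) (cosh y) (sinh y) => *; lra.
Qed.

End Exponential.

(** * The function h and its inverse *)

Section HFunction.
Context {R : realType}.

Lemma hfun0 : hfun (0 : R) = 0.
Proof. by rewrite /hfun addr0 ln1 mulr0 subr0. Qed.

Lemma hinvP (y : R) : 0 <= y -> 0 <= hinv y /\ hfun (hinv y) = y.
Proof.
move=> y0; apply: (@epsilon_spec R (inhabits 0) (fun u => 0 <= u /\ hfun u = y)).
(* An upper end for the intermediate value theorem: 1 + b = e^(1+y) gives h(b) = y e^(1+y) + 1 >=
   y. *)
pose b : R := expR (1 + y) - 1.
have b0 : 0 <= b by rewrite subr_ge0 -expR0 ler_expR addr_ge0.
have hb : y <= hfun b.
  have -> : hfun b = expR (1 + y) * (1 + y) - (expR (1 + y) - 1).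
    by rewrite /hfun /b [1 + (_ - _)]addrC subrK expRK.
  have := expR_ge1Dx (1 + y).
  by move: (expR _) => e; nra.
have [||u ub uE] := @IVT R hfun 0 b y b0.
- apply: continuous_in_subspaceT => u; rewrite inE /= in_itv /= => /andP[u0 _].
  have u1 : 0 < 1 + u by rewrite ltr_pwDl.
  have c1 : {for u, continuous (fun z : R => 1 + z)}.
    by apply: cvgD; [exact: cvg_cst|exact: cvg_id].
  apply: cvgB; last exact: cvg_id.
  apply: cvgM; first exact: c1.
  have c2 : {for u, continuous (@ln R \o (fun z : R => 1 + z))}.
    by apply: continuous_comp; [exact: c1|exact: continuous_ln].
  exact: c2.
- by rewrite hfun0 ge_min y0 /= le_max hb orbT.
by exists u; split => //; move: ub; rewrite in_itv /= => /andP[].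
Qed.

End HFunction.

(** * Integrals of real random variables and the pull-out property *)

Section Expectation.
Context {d : measure_display} {Omega : measurableType d} {R : realType}.
Context (P : probability Omega R).
Implicit Types (f g Y Z : Omega -> R) (A : set Omega).

Local Notation intble f := (P.-integrable setT (EFin \o f)).

Lemma bounded_has_bound f (K : R) : (forall w, `|f w| <= K) ->
  [bounded f w | w in setT].
Proof.
move=> fK; exists K; split; first exact: num_real.
by move=> M KM w _; exact: le_trans (fK w) (ltW KM).
Qed.

Lemma bounded_intble f (K : R) : measurable_fun setT f ->
  (forall w, `|f w| <= K) -> intble f.
Proof.
move=> mf fK; apply: measurable_bounded_integrable => //.
  by have := probability_setT P => /= ->; exact: ltry.
exact: bounded_has_bound fK.
Qed.

Lemma intbleM Z Y (K : R) : measurable_fun setT Z ->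
  (forall w, `|Z w| <= K) -> intble Y -> intble (fun w => Z w * Y w).
Proof.
move=> mZ ZK iY.
exact: (integrableMr measurableT mZ (bounded_has_bound ZK) iY).
Qed.

Lemma intbleD f g : intble f -> intble g -> intble (fun w => f w + g w).
Proof. by move=> fi gi; exact: (integrableD measurableT fi gi). Qed.

Lemma intbleB f g : intble f -> intble g -> intble (fun w => f w - g w).
Proof. by move=> fi gi; exact: (integrableB measurableT fi gi). Qed.

Lemma intbleZl (a : R) f : intble f -> intble (fun w => a * f w).
Proof. by move=> fi; exact: (integrableZl measurableT a fi). Qed.

Lemma Rintegral_indic A f : \int[P]_(w in A) f w = \int[P]_w (\1_A w * f w).
Proof.
rewrite Rintegral_mkcond; apply: eq_Rintegral => w _.
by rewrite patchE indicE; case: (w \in A); rewrite ?mul1r ?mul0r.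
Qed.

Lemma ae_le_Rintegral f g : intble f -> intble g ->
  {ae P, forall w, f w <= g w} -> \int[P]_w f w <= \int[P]_w g w.
Proof.
move=> fi gi [N [mN PN sN]].
have mD : measurable (setT `\` N) by exact: measurableD.
rewrite /Rintegral (negligible_integral mN measurableT fi PN).
rewrite (negligible_integral mN measurableT gi PN).
apply: le_Rintegral => //; try by apply: integrableS (_ : P.-integrable setT _).
by move=> w [_ Nw]; apply: contrapT => h; apply: Nw; exact: sN.
Qed.

(** The sum counts the positive integers up to z, so it is the integer part of z. *)
Lemma staircase_approx (N : nat) (z : R) : 0 <= z <= N%:R ->
  z - 1 <= \sum_(k < N) ((k.+1%:R : R) <= z)%R%:R <= z.
Proof.
elim: N z => [|N IHN] z /andP[z0 zN].
  by rewrite big_ord0; apply/andP; split; lra.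
rewrite big_ord_recl /=; have [z1|z1] := leP 1 z.
  have /IHN : 0 <= z - 1 <= N%:R by rewrite -natr1 in zN; apply/andP; split; lra.
  rewrite (eq_bigr (fun k : 'I_N => ((k.+2%:R : R) <= z)%R%:R)).
    rewrite /= mulr1n; move: (\sum_(_ < _) _) => S /andP[? ?].
    by apply/andP; split; lra.
  by move=> k _; rewrite -[k.+2%:R]natr1 lerBrDr.
rewrite big1 ?addr0 => [|k _]; first by rewrite mulr0n; apply/andP; split; lra.
rewrite leNgt (lt_le_trans z1) // ler1n //.
Qed.

Section PullOut.
Context (G : set (set Omega)).
Hypothesis sG : sigma_algebra setT G.
Hypothesis GM : G `<=` measurable.

Lemma Rmeas_measurable f : Rmeas_wrt G f -> measurable_fun setT f.
Proof. by move=> Gf _ B mB; rewrite setTI; apply: GM; exact: Gf. Qed.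

(* Uniform approximation of the G-measurable factor by staircases. *)
Lemma pull_out_null (D Z : Omega -> R) (K : R) : intble D -> Rmeas_wrt G Z ->
  (forall w, `|Z w| <= K) ->
  (forall A, G A -> \int[P]_(w in A) D w = 0) ->
  \int[P]_w (Z w * D w) = 0.
Proof.
move=> iD GZ ZK D0; have mZ := Rmeas_measurable GZ.
have ED : \int[P]_w D w = 0.
  by apply: D0; case: sG => G0 GC _; rewrite -(setD0 setT); exact: GC.
have iZD := intbleM mZ ZK iD.
set c := \int[P]_w `|D w|.
have c0 : 0 <= c by apply: Rintegral_ge0.
have K0 : 0 <= K by exact: le_trans (normr_ge0 _) (ZK point).
suff key m : `|\int[P]_w (Z w * D w)| <= m.+1%:R^-1 * c.
  apply/eqP; rewrite -normr_le0 leNgt; apply/negP => h.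
  pose m := Num.truncn (c / `|\int[P]_w (Z w * D w)|).
  have := key m; rewrite leNgt => /negP; apply.
  rewrite mulrC ltr_pdivrMr ?ltr0n // mulrC -ltr_pdivrMr //.
  exact: truncnS_gt.
(* The shift by [K] makes M (Z + K) nonnegative and costs nothing, as D has integral 0. Its integer
   part [S] is a sum of indicators of sets of [G], so S D integrates to 0, and the error is at most
   |D|; dividing by [M] gives the bound. *)
pose M : R := m.+1%:R; have M0 : 0 < M by rewrite ltr0n.
pose N := (Num.truncn (M * (K + K))).+1.
pose A (k : nat) := [set w | (k.+1%:R <= M * (Z w + K))%R].
have GA k : G (A k).
  have -> : A k = Z @^-1` `[k.+1%:R / M - K, +oo[.
    apply/seteqP; split => w /=; rewrite in_itv /= andbT;
    by rewrite lerBlDr ler_pdivrMr // mulrC.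
  exact: GZ.
have mA k : measurable (A k) by exact: GM.
pose S w : R := \sum_(k < N) \1_(A k) w.
have SE w : M * (Z w + K) - 1 <= S w <= M * (Z w + K).
  have -> : S w = \sum_(k < N) ((k.+1%:R : R) <= M * (Z w + K))%R%:R.
    apply: eq_bigr => k _; rewrite indicE; congr (_%:R); congr nat_of_bool.
    by apply/idP/idP => h; [rewrite inE in h|rewrite inE].
  have := ZK w; rewrite ler_norml => /andP[Z1 Z2].
  apply: staircase_approx; apply/andP; split.
    by apply: mulr_ge0; [exact: ltW|lra].
  apply: le_trans (ltW (truncnS_gt _)).
  by apply: ler_wpM2l; [exact: ltW|lra].
have [iSD SD0] : intble (fun w => S w * D w) /\ \int[P]_w (S w * D w) = 0.
  rewrite /S; elim: (N) => [|n [iS S0]].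
    have -> : (fun w => (\sum_(k < 0) \1_(A k) w : R) * D w) = cst 0.
      by apply/funext => w; rewrite big_ord0 mul0r.
    split; first exact: finite_measure_integrable_cst.
    by rewrite Rintegral_cst // mul0r.
  have i1 : intble (fun w => \1_(A n) w * D w).
    apply: (intbleM (K := 1)) => // w; rewrite indicE.
    by case: (w \in A n); rewrite ?normr1 ?normr0.
  have -> : (fun w => (\sum_(k < n.+1) \1_(A k) w : R) * D w) =
      (fun w => (\sum_(k < n) \1_(A k) w) * D w + \1_(A n) w * D w).
    by apply/funext => w; rewrite big_ord_recr /= mulrDl.
  split; first exact: intbleD.
  by rewrite RintegralD // S0 add0r -Rintegral_indic D0.
have E1 : \int[P]_w ((M * (Z w + K) - S w) * D w) = M * \int[P]_w (Z w * D w).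
  have -> : (fun w => (M * (Z w + K) - S w) * D w) =
      (fun w => (M * (Z w * D w) + M * K * D w) - S w * D w).
    by apply/funext => w; ring.
  have i1 := intbleZl M iZD; have i2 := intbleZl (M * K) iD.
  rewrite RintegralB ?RintegralD ?RintegralZl // ?ED ?SD0; last exact: intbleD.
  by rewrite mulr0 addr0 subr0.
have iT : intble (fun w => (M * (Z w + K) - S w) * D w).
  have -> : (fun w => (M * (Z w + K) - S w) * D w) =
      (fun w => (M * (Z w * D w) + M * K * D w) - S w * D w).
    by apply/funext => w; ring.
  by apply: intbleB => //; apply: intbleD; exact: intbleZl.
rewrite mulrC ler_pdivlMr // mulrC -[X in X * _](gtr0_norm M0) -normrM -E1.
apply: le_trans (le_normr_Rintegral measurableT iT) _.
apply: le_Rintegral => //; [exact: integrable_norm iT|exact: integrable_norm iD|].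
move=> w _; rewrite normrM -[leRHS]mul1r ler_wpM2r //.
by have /andP[S1 S2] := SE w; rewrite ger0_norm; lra.
Qed.

Lemma pull_out (Y Y' Z : Omega -> R) (K : R) : intble Y -> intble Y' ->
  Rmeas_wrt G Z -> (forall w, `|Z w| <= K) ->
  (forall A, G A -> (\int[P]_(w in A) (Y w)%:E = \int[P]_(w in A) (Y' w)%:E)%E) ->
  \int[P]_w (Z w * Y w) = \int[P]_w (Z w * Y' w).
Proof.
move=> iY iY' GZ ZK YY'; apply/eqP; rewrite -subr_eq0; apply/eqP.
have mZ := Rmeas_measurable GZ.
rewrite -RintegralB //; try exact: intbleM ZK _.
rewrite -(@pull_out_null (fun w => Y w - Y' w) Z K) //; first last.
- move=> A GA; have mA := GM GA.
  rewrite RintegralB // ?/Rintegral ?YY' ?subrr //; exact: (integrableS measurableT).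
- exact: intbleB.
by apply: eq_Rintegral => w _; rewrite mulrBr.
Qed.

End PullOut.
End Expectation.

(** * Functions measurable with respect to a sub-sigma-algebra *)

Section RelativeMeasurability.
Context {d : measure_display} {Omega : measurableType d} {R : realType}.
Context (G : set (set Omega)).
Hypothesis sG : sigma_algebra setT G.
Implicit Types (f g : Omega -> R).

(** A sigma-algebra generates itself. Closure properties of measurable functions can thus be taken
    over to [Rmeas_wrt]. *)
Lemma Rmeas_wrtE f :
  Rmeas_wrt G f <-> measurable_fun (setT : set (g_sigma_algebraType G)) f.
Proof.
split=> [Gf _ B mB|mf B mB].
  by rewrite setTI -[measurable]/(G.-sigma.-measurable) measurable_g_measurableTypeE //; exact: Gf.
have := mf measurableT B mB; rewrite setTI.
by rewrite -[measurable]/(G.-sigma.-measurable) measurable_g_measurableTypeE.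
Qed.

Lemma Rmeas_comp (h : R -> R) f :
  measurable_fun setT h -> Rmeas_wrt G f -> Rmeas_wrt G (fun w => h (f w)).
Proof.
move=> mh Gf B mB; apply: (Gf (h @^-1` B)).
by rewrite -[X in measurable X]setTI; exact: mh.
Qed.

Lemma Rmeas_cst (a : R) : Rmeas_wrt G (fun=> a).
Proof. by apply/Rmeas_wrtE; exact: measurable_cst. Qed.

Lemma RmeasD f g : Rmeas_wrt G f -> Rmeas_wrt G g -> Rmeas_wrt G (fun w => f w + g w).
Proof.
by move=> /Rmeas_wrtE mf /Rmeas_wrtE mg; apply/Rmeas_wrtE; exact: measurable_funD.
Qed.

Lemma RmeasM f g : Rmeas_wrt G f -> Rmeas_wrt G g -> Rmeas_wrt G (fun w => f w * g w).
Proof.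
by move=> /Rmeas_wrtE mf /Rmeas_wrtE mg; apply/Rmeas_wrtE; exact: measurable_funM.
Qed.

Lemma RmeasN f : Rmeas_wrt G f -> Rmeas_wrt G (fun w => - f w).
Proof. by apply: Rmeas_comp; exact: oppr_measurable. Qed.

Lemma RmeasB f g : Rmeas_wrt G f -> Rmeas_wrt G g -> Rmeas_wrt G (fun w => f w - g w).
Proof. by move=> Gf Gg; apply: RmeasD => //; exact: RmeasN. Qed.

Lemma RmeasX f k : Rmeas_wrt G f -> Rmeas_wrt G (fun w => f w ^+ k).
Proof.
move=> Gf; elim: k => [|k IHk]; first exact: Rmeas_cst.
by under eq_fun do rewrite exprS; exact: RmeasM.
Qed.

Lemma Rmeas_sum (I : Type) (s : seq I) (f : I -> Omega -> R) (Q : pred I) :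
  (forall i, Q i -> Rmeas_wrt G (f i)) -> Rmeas_wrt G (fun w => \sum_(i <- s | Q i) f i w).
Proof.
move=> Gf; elim: s => [|i s IHs]; first by under eq_fun do rewrite big_nil; exact: Rmeas_cst.
under eq_fun do rewrite big_cons; case Qi: (Q i) => //.
by apply: RmeasD => //; exact: Gf.
Qed.

Lemma Rmeas_expR f : Rmeas_wrt G f -> Rmeas_wrt G (fun w => expR (f w)).
Proof. by apply: Rmeas_comp; exact: measurable_expR. Qed.

Lemma Rmeas_sqrt f : Rmeas_wrt G f -> Rmeas_wrt G (fun w => Num.sqrt (f w)).
Proof.
by apply: Rmeas_comp; apply: continuous_measurable_fun; exact: sqrt_continuous.
Qed.

Lemma Rmeas_inv_ge0 f : (forall w, 0 <= f w) ->
  Rmeas_wrt G f -> Rmeas_wrt G (fun w => (f w)^-1).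
Proof.
move=> f0 Gf; have -> : (fun w => (f w)^-1) = (fun w => f w `^ (- 1)).
  by apply/funext => w; rewrite powR_inv1.
exact: Rmeas_comp (measurable_powR (- 1)) Gf.
Qed.

Lemma Rmeas_indic A : G A -> Rmeas_wrt G (\1_A : Omega -> R).
Proof.
move=> GA; apply/Rmeas_wrtE; apply: measurable_indic.
by rewrite -[measurable]/(G.-sigma.-measurable) measurable_g_measurableTypeE.
Qed.

Lemma Rmeas_lt f (a : R) : Rmeas_wrt G f -> G [set w | f w < a].
Proof.
move=> Gf; have -> : [set w | f w < a] = f @^-1` `]-oo, a[.
  by apply/seteqP; split => w /=; rewrite in_itv.
exact: Gf.
Qed.

Lemma Rmeas_cosh f : Rmeas_wrt G f -> Rmeas_wrt G (fun w => cosh (f w)).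
Proof.
move=> Gf; apply: RmeasM; last exact: Rmeas_cst.
by apply: RmeasD; apply: Rmeas_expR => //; exact: RmeasN.
Qed.

Lemma Rmeas_sinh f : Rmeas_wrt G f -> Rmeas_wrt G (fun w => sinh (f w)).
Proof.
move=> Gf; apply: RmeasM; last exact: Rmeas_cst.
by apply: RmeasB; apply: Rmeas_expR => //; exact: RmeasN.
Qed.

End RelativeMeasurability.

Lemma Rmeas_sub {d : measure_display} {Omega : measurableType d} {R : realType}
    (G G' : set (set Omega)) (f : Omega -> R) :
  G `<=` G' -> Rmeas_wrt G f -> Rmeas_wrt G' f.
Proof. by move=> GG' Gf B mB; apply: GG'; exact: Gf. Qed.

Lemma filtration_le {d : measure_display} {Omega : measurableType d}
    (F : nat -> set (set Omega)) (s t : nat) :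
  filtration F -> (s <= t)%N -> F s `<=` F t.
Proof.
move=> fF; elim: t => [|t IHt]; first by rewrite leqn0 => /eqP ->.
rewrite leq_eqVlt => /orP[/eqP -> //|]; rewrite ltnS => /IHt st.
by apply: subset_trans st _; case: (fF t).
Qed.

(** * The stopped supermartingale, for abstract real processes *)

Section SelfNormalizedTail.
Context {d : measure_display} {Omega : measurableType d} {R : realType}.
Context (P : probability Omega R) (F : nat -> set (set Omega)) (n : nat).
Context (eps sigma g b q N : nat -> Omega -> R) (B C : R).
Hypothesis fF : filtration F.
Hypothesis B_gt0 : 0 < B.
Hypothesis eps_meas : forall t, (t < n)%N -> Rmeas_wrt (F t.+1) (eps t.+1).
Hypothesis eps_le : forall t w, (t < n)%N -> `|eps t.+1 w| <= B.
Hypothesis eps_mean : forall t, (t < n)%N ->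
  cond_exp_spec P (F t) (eps t.+1) (fun=> 0).
Hypothesis eps_var : forall t, (t < n)%N -> exists2 v,
  cond_exp_spec P (F t) (fun w => eps t.+1 w ^+ 2) v &
  {ae P, forall w, v w <= sigma t.+1 w ^+ 2}.
Hypothesis sigma_meas : forall t, (t < n)%N -> Rmeas_wrt (F t) (sigma t.+1).
Hypothesis g_meas : forall t, (t < n)%N -> Rmeas_wrt (F t) (g t.+1).
Hypothesis b_meas : forall t, (t < n)%N -> Rmeas_wrt (F t) (b t.+1).
Hypothesis q_meas : forall t, (t < n)%N -> Rmeas_wrt (F t) (q t.+1).
Hypothesis N_meas : forall t, (t <= n)%N -> Rmeas_wrt (F t) (N t).
Hypothesis g01 : forall t w, (t < n)%N -> 0 <= g t.+1 w <= 1.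
Hypothesis q_ge0 : forall t w, (t < n)%N -> 0 <= q t.+1 w.
Hypothesis q_le : forall t w, (t < n)%N -> q t.+1 w <= N t w.
Hypothesis N_ge0 : forall t w, 0 <= N t w.
Hypothesis b_le : forall t w, (t < n)%N -> b t.+1 w ^+ 2 <= q t.+1 w * g t.+1 w.
Hypothesis N0 : forall w, N 0 w = 0.
Hypothesis NS : forall t w, (t < n)%N ->
  N t.+1 w = q t.+1 w + 2 * eps t.+1 w * b t.+1 w + eps t.+1 w ^+ 2 * g t.+1 w.

Let S t w := \sum_(i < t) sigma i.+1 w ^+ 2 * g i.+1 w.
Hypothesis S_le : {ae P, forall w, S n w <= C ^+ 2}.

Context (lam r : R).
Hypothesis lam_gt0 : 0 < lam.
Hypothesis r_gt0 : 0 < r.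

Let phi := (expR (lam * B) - 1 - lam * B) / B ^+ 2.
Let Y t w := Num.sqrt (N t w).
Let L t w := expR (- phi * S t w) * cosh (lam * Y t w).

Local Notation intble f := (P.-integrable setT (EFin \o f)).

Let sF t : sigma_algebra setT (F t). Proof. by case: (fF t). Qed.
Let FM t : F t `<=` measurable. Proof. by case: (fF t). Qed.

Let phi_ge0 : 0 <= phi.
Proof. by rewrite divr_ge0 ?sqr_ge0 // expR_sub1_sub_ge0. Qed.

Let b_norm_le t w : (t < n)%N -> `|b t.+1 w| <= Num.sqrt (q t.+1 w) * Num.sqrt (g t.+1 w).
Proof.
move=> tn; rewrite -sqrtrM ?q_ge0 // -sqrtr_sqr ler_wsqrtr //.
exact: b_le.
Qed.

Let sqrt_g_le1 t w : (t < n)%N -> Num.sqrt (g t.+1 w) <= 1.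
Proof. by move=> tn; rewrite -sqrtr1 ler_wsqrtr //; case/andP: (g01 w tn). Qed.

(** One step adds at most B, since N_(t+1) <= (Y_t + B)^2. The bound is deterministic, so [L t] is
    bounded and hence integrable. *)
Let Y_le t w : (t <= n)%N -> Y t w <= t%:R * B.
Proof.
elim: t => [_|t IHt tn]; first by rewrite /Y N0 sqrtr0 mul0r.
apply: (@le_trans _ _ (Y t w + B)); last first.
  by rewrite -natr1 mulrDl mul1r lerD2r IHt // ltnW.
have Y0 : 0 <= Y t w := sqrtr_ge0 _.
rewrite -[leRHS]ger0_norm; last by rewrite addr_ge0 // ltW.
rewrite -sqrtr_sqr {1}/Y ler_wsqrtr //.
have sq : Num.sqrt (q t.+1 w) <= Y t w by rewrite ler_wsqrtr // q_le.
have bY : `|b t.+1 w| <= Y t w.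
  apply: le_trans (b_norm_le w tn) _; rewrite -[leRHS]mulr1.
  by rewrite ler_pM ?sqrtr_ge0 // sqrt_g_le1.
have eB := eps_le w tn; have /andP[g0 g1] := g01 w tn.
have eb : eps t.+1 w * b t.+1 w <= B * Y t w.
  by apply: le_trans (ler_norm _) _; rewrite normrM ler_pM.
have eg : eps t.+1 w ^+ 2 * g t.+1 w <= B ^+ 2.
  rewrite -[leRHS]mulr1 ler_pM ?sqr_ge0 //.
  by rewrite -real_normK ?num_real // ler_sqr ?nnegrE // ltW.
have NY : Y t w ^+ 2 = N t w by rewrite sqr_sqrtr.
have qN := q_le w tn.
by rewrite NS // sqrrD NY mulr2n; lra.
Qed.

Let cosh_Y_le t w : (t <= n)%N -> cosh (lam * Y t w) <= cosh (lam * (t%:R * B)).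
Proof.
move=> tn; apply: ler_cosh; rewrite mulr_ge0 ?sqrtr_ge0 ?(ltW lam_gt0) //=.
by rewrite ler_wpM2l ?(ltW lam_gt0) // Y_le.
Qed.

Let term_ge0 t w : (t < n)%N -> 0 <= sigma t.+1 w ^+ 2 * g t.+1 w.
Proof. by move=> tn; rewrite mulr_ge0 ?sqr_ge0 //; case/andP: (g01 w tn). Qed.

Let SS t w : S t.+1 w = S t w + sigma t.+1 w ^+ 2 * g t.+1 w.
Proof. by rewrite /S big_ord_recr. Qed.

Let S_ge0 t w : (t <= n)%N -> 0 <= S t w.
Proof.
move=> tn; apply: sumr_ge0 => i _; apply: term_ge0.
exact: leq_trans (ltn_ord i) tn.
Qed.

Let S_mono t w : (t <= n)%N -> S t w <= S n w.
Proof.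
move=> tn; rewrite -(subnK tn); have : (n - t + t <= n)%N by rewrite subnK.
elim: (n - t)%N => [|k IHk] //; rewrite addSn => ktn; rewrite SS.
by apply: le_trans (IHk (ltnW ktn)) _; rewrite lerDl term_ge0.
Qed.

(** [S] is predictable, so the weight of [L t.+1] counts as a constant given [F t]. *)
Let S_meas t : (t < n)%N -> Rmeas_wrt (F t) (S t.+1).
Proof.
move=> tn; apply: Rmeas_sum => // i _.
have it : (i <= t)%N by rewrite -ltnS.
have i_n : (i < n)%N := leq_ltn_trans it tn.
apply: (Rmeas_sub (filtration_le fF it)); apply: RmeasM => //; last exact: g_meas.
by apply: RmeasX => //; exact: sigma_meas.
Qed.

Let Y_meas t : (t <= n)%N -> Rmeas_wrt (F t) (Y t).
Proof. by move=> tn; apply: Rmeas_sqrt; exact: N_meas. Qed.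

Let weight_meas t : (t <= n)%N -> Rmeas_wrt (F t) (fun w => expR (- phi * S t w)).
Proof.
move=> tn; apply: Rmeas_expR; apply: RmeasM => //; first exact: Rmeas_cst.
case: t tn => [_|t tn]; last first.
  exact: Rmeas_sub (filtration_le fF (leqnSn t)) (S_meas tn).
by rewrite /S; under eq_fun do rewrite big_ord0; exact: Rmeas_cst.
Qed.

Let weight_le1 t w : (t <= n)%N -> expR (- phi * S t w) <= 1.
Proof.
by move=> tn; rewrite -expR0 ler_expR mulNr oppr_le0 mulr_ge0 ?S_ge0.
Qed.

Let L_meas t : (t <= n)%N -> Rmeas_wrt (F t) (L t).
Proof.
move=> tn; apply: RmeasM => //; first exact: weight_meas.
by apply: Rmeas_cosh => //; apply: RmeasM => //; [exact: Rmeas_cst|exact: Y_meas].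
Qed.

Let L_ge0 t w : 0 <= L t w.
Proof. by rewrite mulr_ge0 ?expR_ge0 // ltW // cosh_gt0. Qed.

Let L_le t w : (t <= n)%N -> `|L t w| <= cosh (lam * (t%:R * B)).
Proof.
move=> tn; rewrite ger0_norm //; apply: le_trans (cosh_Y_le w tn).
by rewrite -[leRHS]mul1r ler_wpM2r ?weight_le1 // ltW // cosh_gt0.
Qed.

Let indic_norm_le1 A (w : Omega) : `|\1_A w : R| <= 1.
Proof. by rewrite indicE; case: (w \in A); rewrite ?normr1 ?normr0. Qed.

Let L_intble t A : measurable A -> (t <= n)%N -> intble (fun w => \1_A w * L t w).
Proof.
move=> mA tn; apply: (intbleM (K := 1)) => //.
by apply: bounded_intble (fun w => L_le w tn); exact: Rmeas_measurable (L_meas tn).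
Qed.

(** In the application this is lam times the norm of T_(t+1)^(-1/2) M_t: it is known at time t and
    at most lam Y_t. *)
Let s t w := lam * Num.sqrt (q t.+1 w).

Let pinelis_step t w : (t < n)%N ->
  cosh (lam * Y t.+1 w) <= cosh (s t w)
    + lam ^+ 2 * b t.+1 w * (sinh (s t w) / s t w) * eps t.+1 w
    + phi * g t.+1 w * cosh (s t w) * eps t.+1 w ^+ 2.
Proof.
move=> tn; have /andP[g0 g1] := g01 w tn.
pose e := eps t.+1 w; pose y := lam * (`|e| * Num.sqrt (g t.+1 w)).
have s0 : 0 <= s t w by rewrite mulr_ge0 ?sqrtr_ge0 // ltW.
have y0 : 0 <= y by rewrite !mulr_ge0 ?sqrtr_ge0 // ltW.
have csy : `|lam ^+ 2 * (e * b t.+1 w)| <= s t w * y.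
  rewrite normrM (ger0_norm (sqr_ge0 lam)) normrM.
  have -> : s t w * y = lam ^+ 2 *
    (`|e| * (Num.sqrt (q t.+1 w) * Num.sqrt (g t.+1 w))) by rewrite /s /y; ring.
  by rewrite ler_wpM2l ?sqr_ge0 // ler_wpM2l // b_norm_le.
have pE : (lam * Y t.+1 w) ^+ 2 = s t w ^+ 2 + 2 * (lam ^+ 2 * (e * b t.+1 w)) + y ^+ 2.
  rewrite /s /y !exprMn !sqr_sqrtr // ?q_ge0 // real_normK ?num_real // NS // -/e.
  by ring.
apply: le_trans (cosh_step s0 y0 csy pE) _.
(* Here y is lam B times the ratio |e| sqrt g / B, which is at most 1; [exp_remainder_scale] turns
   the squared ratio into the factor phi g e^2. *)
have rem : expR y - 1 - y <= phi * g t.+1 w * e ^+ 2.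
  have t01 : 0 <= `|e| * Num.sqrt (g t.+1 w) / B <= 1.
    rewrite divr_ge0 ?mulr_ge0 ?sqrtr_ge0 ?(ltW B_gt0) //= ler_pdivrMr // mul1r.
    by rewrite -[leRHS]mulr1 ler_pM ?sqrtr_ge0 ?eps_le ?sqrt_g_le1.
  have := exp_remainder_scale t01 (ltW (mulr_gt0 lam_gt0 B_gt0)).
  have B0 : B != 0 by rewrite gt_eqF.
  have -> : `|e| * Num.sqrt (g t.+1 w) / B * (lam * B) = y by rewrite /y; field.
  rewrite !exprMn sqr_sqrtr // real_normK ?num_real // => h.
  by apply: le_trans h _; rewrite /phi exprVn le_eqVlt; apply/orP; left; apply/eqP; ring.
have := ler_wpM2l (ltW (cosh_gt0 (s t w))) rem.
by rewrite -/e; move: (cosh (s t w)) (sinh (s t w) / s t w) => c sh; lra.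
Qed.

Let s_ge0 t w : 0 <= s t w.
Proof. by rewrite mulr_ge0 ?sqrtr_ge0 // ltW. Qed.

Let s_meas t : (t < n)%N -> Rmeas_wrt (F t) (s t).
Proof.
move=> tn; apply: RmeasM => //; first exact: Rmeas_cst.
by apply: Rmeas_sqrt; exact: q_meas.
Qed.

Let cosh_s_le t w : (t < n)%N -> cosh (s t w) <= cosh (lam * Y t w).
Proof.
move=> tn; apply: ler_cosh; rewrite s_ge0 /=.
by rewrite ler_wpM2l ?ler_wsqrtr ?q_le // ltW.
Qed.

(** Boundedness of the coefficient of [eps], as needed for [pull_out]. It follows from lam |b| <= s
    and sinh <= cosh. *)
Let drift_le t w : (t < n)%N ->
  `|lam ^+ 2 * b t.+1 w * (sinh (s t w) / s t w)| <= lam * cosh (s t w).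
Proof.
move=> tn; have s0 := s_ge0 t w.
have sh0 : 0 <= sinh (s t w) := le_trans s0 (sinh_ge s0).
have shc : sinh (s t w) <= cosh (s t w).
  by rewrite /sinh /cosh; have := expR_gt0 (- s t w); lra.
have lb : lam * `|b t.+1 w| <= s t w.
  rewrite ler_wpM2l ?(ltW lam_gt0) //; apply: le_trans (b_norm_le w tn) _.
  by rewrite -[leRHS]mulr1 ler_wpM2l ?sqrtr_ge0 // sqrt_g_le1.
rewrite normrM [X in X * _]normrM (ger0_norm (sqr_ge0 lam)).
rewrite [X in _ * X]ger0_norm; last exact: divr_ge0.
move: (sinh _) sh0 shc => sh sh0 shc; have [sz|sz] := eqVneq (s t w) 0.
  by rewrite sz invr0 !mulr0 mulr_ge0 // ltW // cosh_gt0.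
have sgt : 0 < s t w by rewrite lt_neqAle eq_sym sz.
rewrite expr2 -!mulrA ler_wpM2l ?(ltW lam_gt0) //; apply: le_trans shc.
rewrite mulrA mulrCA -[leRHS]mulr1 ler_wpM2l // ler_pdivrMr // mul1r.
exact: lb.
Qed.

(** From 1 + x <= e^x: the factor 1 + phi g v is at most exp (phi g sigma^2), which is the drop of
    the weight from t to t+1. *)
Let compensator t w (v : R) : (t < n)%N -> v <= sigma t.+1 w ^+ 2 ->
  expR (- phi * S t.+1 w) * cosh (s t w) * (1 + phi * g t.+1 w * v) <= L t w.
Proof.
move=> tn vs; have /andP[g0 g1] := g01 w tn.
have c0 := cosh_gt0 (s t w).
apply: (@le_trans _ _ (expR (- phi * S t w) * cosh (s t w))); last first.
  by rewrite ler_wpM2l ?expR_ge0 // cosh_s_le.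
rewrite mulrAC ler_wpM2r ?(ltW c0) //.
rewrite SS [- phi * _]mulrDr expRD.
rewrite -[leRHS]mulr1 -[leLHS]mulrA ler_wpM2l ?expR_ge0 //.
rewrite [- phi * _]mulNr expRN ler_pdivrMl ?expR_gt0 // mulr1.
apply: le_trans (expR_ge1Dx _); rewrite lerD2l -mulrA ler_wpM2l //.
by rewrite mulrC ler_wpM2r.
Qed.

Lemma supermartingale_step t A : (t < n)%N -> F t A ->
  \int[P]_w (\1_A w * L t.+1 w) <= \int[P]_w (\1_A w * L t w).
Proof.
move=> tn FA; have mA := FM FA.
have [_ _ mean0] := eps_mean tn.
have [v [v_meas v_int v_eq] v_le] := eps_var tn.
pose K := cosh (lam * (t%:R * B)).
pose W w := \1_A w * expR (- phi * S t.+1 w).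
have W_meas : Rmeas_wrt (F t) W.
  apply: RmeasM => //; first exact: Rmeas_indic.
  apply: Rmeas_expR; apply: RmeasM => //; first exact: Rmeas_cst.
  exact: S_meas.
have W_le w : `|W w| <= 1.
  rewrite normrM -[leRHS]mulr1 ler_pM ?indic_norm_le1 //.
  by rewrite ger0_norm ?expR_ge0 // weight_le1.
have c_meas : Rmeas_wrt (F t) (fun w => cosh (s t w)).
  by apply: Rmeas_cosh => //; exact: s_meas.
have c_le w : `|cosh (s t w)| <= K.
  rewrite ger0_norm ?(ltW (cosh_gt0 _)) //.
  by apply: le_trans (cosh_s_le w tn) _; apply: cosh_Y_le; exact: ltnW.
have K0 : 0 <= K by rewrite ltW // cosh_gt0.
(* The bound of [pinelis_step], times [W], is Z0 + Z1 eps + Z2 eps^2 with bounded, [F t]-measurable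
   coefficients. Pulling them out kills the middle term and replaces eps^2 by its conditional
   expectation [v]. *)
pose Z0 w := W w * cosh (s t w).
pose Z1 w := W w * (lam ^+ 2 * b t.+1 w * (sinh (s t w) / s t w)).
pose Z2 w := W w * (phi * g t.+1 w * cosh (s t w)).
have Z0_meas : Rmeas_wrt (F t) Z0 by exact: RmeasM.
have Z1_meas : Rmeas_wrt (F t) Z1.
  apply: RmeasM => //; apply: RmeasM => //.
    by apply: RmeasM => //; [exact: Rmeas_cst|exact: b_meas].
  apply: RmeasM => //; first by apply: Rmeas_sinh => //; exact: s_meas.
  by apply: Rmeas_inv_ge0 => //; exact: s_meas.
have Z2_meas : Rmeas_wrt (F t) Z2.
  apply: RmeasM => //; apply: RmeasM => //.
  by apply: RmeasM => //; [exact: Rmeas_cst|exact: g_meas].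
have Z0_le w : `|Z0 w| <= 1 * K by rewrite normrM ler_pM.
have Z1_le w : `|Z1 w| <= 1 * (lam * K).
  rewrite normrM ler_pM //; apply: le_trans (drift_le w tn) _.
  rewrite ler_wpM2l ?(ltW lam_gt0) //; apply: le_trans (c_le w); exact: ler_norm.
have Z2_le w : `|Z2 w| <= 1 * (phi * 1 * K).
  rewrite normrM ler_pM // normrM ler_pM // normrM (ger0_norm phi_ge0).
  by rewrite ler_wpM2l //; case/andP: (g01 w tn) => ? ?; rewrite ger0_norm.
have eps_m : measurable_fun setT (eps t.+1).
  exact: (Rmeas_measurable (@FM t.+1) (eps_meas tn)).
have eps_i : intble (eps t.+1) by apply: bounded_intble eps_m (fun w => eps_le w tn).
have eps2_i : intble (fun w => eps t.+1 w ^+ 2).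
  have := intbleM eps_m (fun w => eps_le w tn) eps_i.
  by under [X in P.-integrable _ (_ \o X)]eq_fun do rewrite -expr2.
have m (f : Omega -> R) : Rmeas_wrt (F t) f -> measurable_fun setT f.
  exact: (Rmeas_measurable (@FM t)).
have i0 : intble Z0 by exact: bounded_intble (m _ Z0_meas) Z0_le.
have i1 := intbleM (m _ Z1_meas) Z1_le eps_i.
have i2 := intbleM (m _ Z2_meas) Z2_le eps2_i.
have i2v := intbleM (m _ Z2_meas) Z2_le v_int.
have E1 : \int[P]_w (Z1 w * eps t.+1 w) = 0.
  have i00 : intble (fun=> 0 : R) by exact: finite_measure_integrable_cst.
  rewrite (pull_out (sF t) (@FM t) eps_i i00 Z1_meas Z1_le mean0).
  by under eq_Rintegral do rewrite mulr0; rewrite Rintegral_cst // mul0r.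
have E2 : \int[P]_w (Z2 w * eps t.+1 w ^+ 2) = \int[P]_w (Z2 w * v w).
  exact: (pull_out (sF t) (@FM t) eps2_i v_int Z2_meas Z2_le v_eq).
have i012 := intbleD (intbleD i0 i1) i2.
apply: (@le_trans _ _ (\int[P]_w (Z0 w + Z1 w * eps t.+1 w + Z2 w * eps t.+1 w ^+ 2))).
  apply: le_Rintegral => //; first exact: L_intble.
  move=> w _; have -> : Z0 w + Z1 w * eps t.+1 w + Z2 w * eps t.+1 w ^+ 2 =
      W w * (cosh (s t w)
    + lam ^+ 2 * b t.+1 w * (sinh (s t w) / s t w) * eps t.+1 w
    + phi * g t.+1 w * cosh (s t w) * eps t.+1 w ^+ 2).
    by rewrite /Z0 /Z1 /Z2; ring.
  have -> : \1_A w * L t.+1 w = W w * cosh (lam * Y t.+1 w) by rewrite /W /L mulrA.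
  apply: ler_wpM2l (pinelis_step w tn).
  by rewrite /W mulr_ge0 ?expR_ge0 // indicE.
have i01 := intbleD i0 i1.
rewrite RintegralD // (RintegralD _ i0 i1) // E1 E2 addr0 -RintegralD //.
apply: ae_le_Rintegral; [exact: intbleD|exact: L_intble (ltnW tn)|].
apply: filterS v_le => w vw; apply: le_trans (_ : \1_A w * _ <= _); last first.
  by apply: ler_wpM2l (compensator tn vw); rewrite indicE.
by rewrite le_eqVlt; apply/orP; left; apply/eqP; rewrite /Z0 /Z2 /W; ring.
Qed.

Let A t := [set w | forall i, (i <= t)%N -> Y i w < r].

Let AS t : A t.+1 = A t `&` [set w | Y t.+1 w < r].
Proof.
apply/seteqP; split => [w h|w [h1 h2] i].
  by split; [move=> i it; apply: h; exact: leqW|exact: h].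
by rewrite leq_eqVlt => /orP[/eqP ->|/h1].
Qed.

Let FA t : (t <= n)%N -> F t (A t).
Proof.
have FI i (U V : set Omega) : F i U -> F i V -> F i (U `&` V).
  move=> FU FV; have := @measurableI _ (g_sigma_algebraType (F i)) U V.
  by rewrite -[measurable]/((F i).-sigma.-measurable) measurable_g_measurableTypeE //; exact.
elim: t => [_|t IHt tn].
  have -> : A 0 = [set w | Y 0 w < r].
    apply/seteqP; split => [w h|w h i]; first exact: h.
    by rewrite leqn0 => /eqP ->.
  by apply: Rmeas_lt; exact: Y_meas.
rewrite AS; apply: FI; last by apply: Rmeas_lt; exact: Y_meas.
by have [_ _ ] := fF t; apply; apply: IHt; exact: ltnW.
Qed.

(** A lower bound for [L] at the moment when [Y] reaches [r], provided that the sum [S] stays below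
    C^2. *)
Let c := cosh (lam * r) * expR (- phi * C ^+ 2).

Let c_le_L t w : (t < n)%N -> S n w <= C ^+ 2 -> r <= Y t.+1 w -> c <= L t.+1 w.
Proof.
move=> tn SC rY; rewrite /c /L mulrC; apply: ler_pM.
- exact: expR_ge0.
- exact: ltW (cosh_gt0 _).
- by rewrite ler_expR !mulNr lerN2 ler_wpM2l // (le_trans (S_mono w tn)).
- by apply: ler_cosh; rewrite mulr_ge0 ?(ltW lam_gt0) ?(ltW r_gt0) //= ler_wpM2l // ltW.
Qed.

(** Stopping without a stopping time: the integrand is frozen at the constant [c] once the level is
    reached, and follows [L] before. Its integral starts at 1 and does not increase. *)
Lemma stopped_expectation_le1 t : (t <= n)%N ->
  \int[P]_w (c * \1_(~` A t) w + \1_(A t) w * L t w) <= 1.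
Proof.
have iC i : (i <= n)%N -> intble (fun w => c * \1_(~` A i) w).
  move=> i_n; apply: intbleZl; apply: (@bounded_intble _ _ _ P _ 1) => //.
  by apply: measurable_indic; apply: measurableC; apply: (@FM i); exact: FA.
elim: t => [_|t IHt tn].
  rewrite [X in X <= _](_ : _ = \int[P]_(w in setT) (1 : R)).
    by rewrite Rintegral_cst // mul1r [X in fine X](probability_setT P).
  apply: eq_Rintegral => w _.
  have Aw : A 0 w by move=> i; rewrite leqn0 => /eqP ->; rewrite /Y N0 sqrtr0.
  have nAw : ~ (~` A 0) w by move=> /(_ Aw).
  rewrite !indicE (memNset nAw) (mem_set Aw).
  rewrite mulr0 add0r mul1r /L /S big_ord0 mulr0 expR0 mul1r /Y N0 sqrtr0 mulr0.
  exact: cosh0.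
have tn' := ltnW tn; have mA i : (i <= n)%N -> measurable (A i).
  by move=> i_n; apply: (@FM i); exact: FA.
apply: le_trans (IHt tn').
(* A crossing at time t+1 replaces [L t.+1] by [c], which is no larger; the remaining comparison of
   [L t.+1] with [L t] takes place on the [F t]-set [A t]. *)
apply: (@le_trans _ _ (\int[P]_w (c * \1_(~` A t) w + \1_(A t) w * L t.+1 w))).
  apply: ae_le_Rintegral.
  - by apply: intbleD; [exact: iC|apply: L_intble => //; exact: mA].
  - by apply: intbleD; [exact: iC|apply: L_intble => //; exact: mA].
  apply: filterS S_le => w Sw; rewrite !indicE !in_setC AS in_setI.
  case Aw: (w \in A t); rewrite /= ?lexx // !(mulr0, mul0r, add0r, mulr1, mul1r, addr0).
  have [Yw|Yw] := ltP (Y t.+1 w) r.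
    by rewrite mem_set //= !(mulr0, mul0r, add0r, mulr1, mul1r, addr0).
  rewrite memNset /=; last by apply/negP; rewrite -leNgt.
  by rewrite !(mulr0, mul0r, add0r, mulr1, mul1r, addr0) c_le_L.
have mAt := mA t tn'.
rewrite (RintegralD measurableT (iC t tn') (L_intble mAt tn)).
rewrite (RintegralD measurableT (iC t tn') (L_intble mAt tn')).
by rewrite lerD2l; apply: supermartingale_step => //; exact: FA.
Qed.

Lemma self_normalized_tail :
  cosh (lam * r) * fine (P [set w | exists2 t, (t <= n)%N & r <= Y t w]) <=
  expR (phi * C ^+ 2).
Proof.
have -> : [set w | exists2 t, (t <= n)%N & r <= Y t w] = ~` A n.
  apply/seteqP; split => w /=.
    by move=> [t tn rY] /(_ t tn); rewrite ltNge rY.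
  move=> h; apply: contrapT => k; apply: h => t tn.
  by rewrite ltNge; apply/negP => rY; apply: k; exists t.
have mA : measurable (~` A n).
  by apply: measurableC; apply: (@FM n); exact: FA.
rewrite -[leRHS]mul1r -ler_pdivrMr ?expR_gt0 // -expRN -mulNr mulrAC -/c.
apply: le_trans (stopped_expectation_le1 (leqnn n)).
have -> : fine (P (~` A n)) = \int[P]_w (\1_(~` A n) w : R).
  by rewrite /Rintegral integral_indic // setIT.
have ii : intble (\1_(~` A n) : Omega -> R).
  by apply: (@bounded_intble _ _ _ P _ 1) => //; exact: measurable_indic.
rewrite -RintegralZl //; apply: le_Rintegral => //.
- exact: intbleZl.
- by apply: intbleD; [exact: intbleZl|apply: L_intble => //; apply: (@FM n); exact: FA].
- by move=> w _; rewrite lerDl mulr_ge0 // indicE.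
Qed.

End SelfNormalizedTail.

(** * Measurability of the scalar products built from the X_i *)

Section HilbertMeasurability.
Context {R : realType} {H : normedModType R} (ip : H -> H -> R).
Context {d : measure_display} {Omega : measurableType d}.
Hypothesis ipP : inner_product ip.
Hypothesis sepH : separable H.

Lemma Rmeas_of_lt (G : set (set Omega)) (f : Omega -> R) :
  sigma_algebra setT G -> (forall a, G [set w | f w < a]) -> Rmeas_wrt G f.
Proof.
move=> sG Gf; apply/Rmeas_wrtE => //.
apply: (measurability _ (RGenInftyO.measurableE R)) => _ [_ [a ->] <-].
rewrite -[measurable]/(G.-sigma.-measurable) measurable_g_measurableTypeE // setTI.
have -> : f @^-1` `]-oo, a[ = [set w | f w < a].
  by apply/seteqP; split => w /=; rewrite in_itv.
exact: Gf.
Qed.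

Lemma Rmeas_norm_sub (G : set (set Omega)) (f : Omega -> H) (x : H) :
  sigma_algebra setT G -> Hmeas_wrt G f -> Rmeas_wrt G (fun w => `|f w - x|).
Proof.
move=> sG Gf; apply: Rmeas_of_lt => // a.
have -> : [set w | `|f w - x| < a] = f @^-1` [set y | `|y - x| < a] by [].
apply: Gf.
have -> : [set y | `|y - x| < a] = (fun y => `|y - x|) @^-1` `]-oo, a[.
  by apply/seteqP; split => y /=; rewrite in_itv.
apply: open_comp; last exact: interval_open.
move=> y _; apply: (@continuous_comp _ _ _ (fun y : H => y - x) (fun z : H => `|z|)).
  by apply: cvgB; [exact: cvg_id|exact: cvg_cst].
exact: norm_continuous.
Qed.

(* [|f - g| < a] iff [|f - x| + |g - x| < a] for some [x] in a countable dense set. *)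
Lemma Rmeas_dist (G : set (set Omega)) (f g : Omega -> H) :
  sigma_algebra setT G -> Hmeas_wrt G f -> Hmeas_wrt G g ->
  Rmeas_wrt G (fun w => `|f w - g w|).
Proof.
move=> sG Gf Gg; apply: Rmeas_of_lt => // a.
have [D [cD dD]] := sepH.
have [D0|[e]] := pfcard_geP cD.
  have : (closure D) 0 by rewrite dD.
  by rewrite D0 closure0.
have -> : [set w | `|f w - g w| < a] =
    \bigcup_k [set w | `|f w - e k| + `|g w - e k| < a].
  apply/seteqP; split => w /=; last first.
    move=> [k _ /= h]; apply: le_lt_trans h.
    have -> : f w - g w = (f w - e k) - (g w - e k) by rewrite opprB addrA subrK.
    exact: ler_normB.
  move=> fga; pose r := (a - `|f w - g w|) / 2.
  have r0 : 0 < r by rewrite divr_gt0 // subr_gt0.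
  have : (closure D) (f w) by rewrite dD.
  move=> /(_ (ball (f w) r)) []; first exact: nbhsx_ballx.
  move=> x [Dx]; rewrite -ball_normE /= => xr.
  have [k _ kx] : (e @` setT) x by exact: (@surj _ _ _ _ e).
  exists k => //=; rewrite kx.
  have : `|g w - x| <= `|f w - g w| + `|f w - x|.
    have -> : g w - x = (f w - x) - (f w - g w) by rewrite opprB [RHS]addrC addrA subrK.
    by rewrite [leRHS]addrC; exact: ler_normB.
  by move: xr fga; rewrite /r; lra.
case: (sG) => _ _; apply => k; apply: Rmeas_lt => //.
by apply: RmeasD => //; exact: Rmeas_norm_sub.
Qed.

(** Polarization leaves only norms and the distance of the two maps; the latter is where
    separability enters. *)
Lemma Rmeas_ip (G : set (set Omega)) (f g : Omega -> H) :
  sigma_algebra setT G -> Hmeas_wrt G f -> Hmeas_wrt G g ->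
  Rmeas_wrt G (fun w => ip (f w) (g w)).
Proof.
move=> sG Gf Gg.
have -> : (fun w => ip (f w) (g w)) =
    (fun w => (`|f w - 0| ^+ 2 + `|g w - 0| ^+ 2 - `|f w - g w| ^+ 2) * 2^-1).
  apply/funext => w; rewrite !subr0 -!(ip_norm ipP) (ipDl ipP) !(ipDr ipP) !(ipNl ipP) !(ipNr ipP).
  by rewrite (ipC ipP (g w)); field.
apply: RmeasM => //; last exact: Rmeas_cst.
apply: RmeasB => //; last by apply: RmeasX => //; exact: Rmeas_dist.
by apply: RmeasD => //; apply: RmeasX => //; exact: Rmeas_norm_sub.
Qed.

Lemma Rmeas_sum_nat (G : set (set Omega)) (m k : nat) (f : nat -> Omega -> R) :
  sigma_algebra setT G -> (forall i, (m <= i < k)%N -> Rmeas_wrt G (f i)) ->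
  Rmeas_wrt G (fun w => \sum_(m <= i < k) f i w).
Proof.
move=> sG Gf; under eq_fun do rewrite big_nat_cond.
by apply: Rmeas_sum => // i; rewrite andbT; exact: Gf.
Qed.

Context (F : nat -> set (set Omega)) (n : nat) (X : nat -> Omega -> H) (rho : R).
Hypothesis fF : filtration F.
Hypothesis rho_gt0 : 0 < rho.
Hypothesis X_meas : forall t, (t < n)%N -> Hmeas_wrt (F t) (X t.+1).

Local Notation J k w := (gram_inv ip (fun i => X i w) rho k).

Let sF t : sigma_algebra setT (F t). Proof. by case: (fF t). Qed.

(** Indices reach t+1 although the sigma-algebra is [F t]: X is predictable, and the step to time
    t+1 involves T_(t+1). *)
Lemma Rmeas_gram_inv t i j k : (t < n)%N -> (0 < i <= t.+1)%N ->
  (0 < j <= t.+1)%N -> (k <= t.+1)%N ->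
  Rmeas_wrt (F t) (fun w => ip (X i w) (J k w (X j w))).
Proof.
move=> tn; elim: k i j => [|k IHk] i j it jt kt.
  under eq_fun do rewrite gram_inv_init // (ipZr ipP).
  apply: RmeasM => //; first exact: Rmeas_cst.
  have XF l : (0 < l <= t.+1)%N -> Hmeas_wrt (F t) (X l).
    case: l => // l /andP[_]; rewrite ltnS => lt U oU.
    by apply: (filtration_le fF lt); apply: X_meas => //; exact: leq_ltn_trans tn.
  by apply: Rmeas_ip => //; exact: XF.
have k1 : (0 < k.+1 <= t.+1)%N by [].
have kt' := ltnW kt.
under eq_fun do rewrite gram_inv_rank1 // (ipDr ipP) (ipNr ipP) (ipZr ipP).
apply: RmeasB => //; first exact: IHk.
apply: RmeasM => //; last exact: IHk.
apply: RmeasM => //; first exact: IHk.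
apply: Rmeas_inv_ge0 => //; last by apply: RmeasD => //; [exact: Rmeas_cst|exact: IHk].
by move=> w; rewrite addr_ge0 // gram_inv_ge0.
Qed.

Context (e : nat -> Omega -> R).
Hypothesis e_meas : forall t, (t < n)%N -> Rmeas_wrt (F t.+1) (e t.+1).

(** The noise is a parameter because M_t is formed both with [eps] and with its clipped version. *)
Definition lincomb t w : H := \sum_(1 <= i < t.+1) e i w *: X i w.

(* [|G_t|^2], [<X_t, T_t^-1 M_(t-1)>], [|T_t^(-1/2) M_(t-1)|^2] and [|T_t^(-1/2) M_t|^2]
   for [T_t = rho I + V_t]. *)
Definition gnorm t w : R := ip (X t w) (J t w (X t w)).
Definition cross t w : R := ip (X t w) (J t w (lincomb t.-1 w)).
Definition shrunk t w : R := ip (lincomb t.-1 w) (J t w (lincomb t.-1 w)).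
Definition selfnorm t w : R := ip (lincomb t w) (J t w (lincomb t w)).

Lemma lincombS t w : lincomb t.+1 w = lincomb t w + e t.+1 w *: X t.+1 w.
Proof. by rewrite /lincomb big_nat_recr. Qed.

Lemma lincomb0 w : lincomb 0 w = 0.
Proof. by rewrite /lincomb big_geq. Qed.

Lemma ip_gram_inv_lincomb k t w x :
  ip x (J k w (lincomb t w)) =
  \sum_(1 <= j < t.+1) e j w * ip x (J k w (X j w)).
Proof.
elim: t => [|t IHt]; first by rewrite lincomb0 gram_inv0 // (ip0r ipP) big_geq.
rewrite lincombS gram_invD // (ipDr ipP) IHt gram_invZ // (ipZr ipP).
by rewrite [RHS]big_nat_recr.
Qed.

Lemma e_meas_le t i : (t < n)%N -> (1 <= i < t.+1)%N -> Rmeas_wrt (F t) (e i).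
Proof.
move=> tn; case: i => // i /andP[_]; rewrite ltnS => it.
apply: (Rmeas_sub (filtration_le fF it)); apply: e_meas.
exact: leq_ltn_trans (ltnW it) tn.
Qed.

Lemma gnorm_meas t : (t < n)%N -> Rmeas_wrt (F t) (gnorm t.+1).
Proof. by move=> tn; apply: Rmeas_gram_inv => //=; rewrite ltnSn. Qed.

Lemma cross_meas t : (t < n)%N -> Rmeas_wrt (F t) (cross t.+1).
Proof.
move=> tn; rewrite /cross /=; under eq_fun do rewrite ip_gram_inv_lincomb.
apply: Rmeas_sum_nat => // j jt; apply: RmeasM => //; first exact: e_meas_le.
by apply: Rmeas_gram_inv => //=; case/andP: jt => -> /ltnW.
Qed.

Lemma quadratic_lincomb_meas t k : (t < n)%N -> (k <= t.+1)%N ->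
  Rmeas_wrt (F t) (fun w => ip (lincomb t w) (J k w (lincomb t w))).
Proof.
move=> tn kt.
have -> : (fun w => ip (lincomb t w) (J k w (lincomb t w))) = (fun w =>
    \sum_(1 <= j < t.+1) e j w *
      \sum_(1 <= i < t.+1) e i w * ip (X j w) (J k w (X i w))).
  apply/funext => w; rewrite ip_gram_inv_lincomb; apply: eq_bigr => j _.
  by rewrite (ipC ipP) gram_inv_sym // ip_gram_inv_lincomb.
apply: Rmeas_sum_nat => // j jt; apply: RmeasM => //; first exact: e_meas_le.
apply: Rmeas_sum_nat => // i it; apply: RmeasM => //; first exact: e_meas_le.
by apply: Rmeas_gram_inv => //; [case/andP: jt => -> /ltnW|case/andP: it => -> /ltnW].
Qed.

Lemma shrunk_meas t : (t < n)%N -> Rmeas_wrt (F t) (shrunk t.+1).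
Proof. by move=> tn; exact: quadratic_lincomb_meas. Qed.

Lemma selfnormS t w : selfnorm t.+1 w =
  shrunk t.+1 w + 2 * e t.+1 w * cross t.+1 w + e t.+1 w ^+ 2 * gnorm t.+1 w.
Proof.
rewrite /selfnorm /shrunk /cross /gnorm /= lincombS gram_invD // gram_invZ //.
rewrite (ipDl ipP) !(ipDr ipP) !(ipZl ipP) !(ipZr ipP).
rewrite (ipC ipP (lincomb t w) (J _ _ (X _ _))) gram_inv_sym //.
by ring.
Qed.

Lemma selfnorm0 w : selfnorm 0 w = 0.
Proof. by rewrite /selfnorm lincomb0 ip0l. Qed.

Lemma selfnorm_meas t : (t <= n)%N -> Rmeas_wrt (F t) (selfnorm t).
Proof.
case: t => [_|t tn].
  by rewrite (_ : selfnorm 0 = fun=> 0); [exact: Rmeas_cst|apply/funext => w; exact: selfnorm0].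
have -> : selfnorm t.+1 = (fun w => shrunk t.+1 w + 2 * e t.+1 w * cross t.+1 w +
    e t.+1 w ^+ 2 * gnorm t.+1 w) by apply/funext => w; exact: selfnormS.
have tt := Rmeas_sub (filtration_le fF (leqnSn t)).
apply: RmeasD => //; last first.
  by apply: RmeasM => //; [apply: RmeasX => //; exact: e_meas|apply: tt; exact: gnorm_meas].
apply: RmeasD => //; first by apply: tt; exact: shrunk_meas.
apply: RmeasM => //; last by apply: tt; exact: cross_meas.
by apply: RmeasM => //; [exact: Rmeas_cst|exact: e_meas].
Qed.

End HilbertMeasurability.

(** * Almost sure versions of conditional moments, and clipping *)

Section ConditionalMoments.
Context {d : measure_display} {Omega : measurableType d} {R : realType}.
Context (P : probability Omega R) (G : set (set Omega)).
Hypothesis sG : sigma_algebra setT G.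
Hypothesis GM : G `<=` measurable.
Implicit Types (Y Z : Omega -> R).

Lemma cond_exp_spec_ae Y Y' Z : measurable_fun setT Y -> measurable_fun setT Y' ->
  {ae P, forall w, Y w = Y' w} -> cond_exp_spec P G Y Z -> cond_exp_spec P G Y' Z.
Proof.
move=> mY mY' YY' [GZ iZ eqZ]; split => // A GA; rewrite -eqZ //.
have mA := GM GA; apply: ae_eq_integral => //.
- by apply/measurable_EFinP; exact: measurable_funS mY'.
- by apply/measurable_EFinP; exact: measurable_funS mY.
- by apply: filterS YY' => w /= -> _.
Qed.

(** Testing Z against its own sign, which is bounded and [G]-measurable, gives a zero integral for
    |Z|. *)
Lemma null_of_null_integrals Z : Rmeas_wrt G Z -> P.-integrable setT (EFin \o Z) ->
  (forall A, G A -> \int[P]_(w in A) Z w = 0) -> {ae P, forall w, Z w = 0}.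
Proof.
move=> GZ iZ Z0; pose N := [set w | Z w < 0].
have GN : G N by exact: Rmeas_lt.
pose sgn w : R := 1 - 2 * \1_N w.
have sgn_meas : Rmeas_wrt G sgn.
  apply: RmeasB => //; first exact: Rmeas_cst.
  by apply: RmeasM => //; [exact: Rmeas_cst|exact: Rmeas_indic].
have sgn_le w : `|sgn w| <= 1.
  rewrite /sgn indicE; case: (w \in N); rewrite ?mulr0 ?subr0 ?normr1 //.
  by rewrite mulr1 ler_norml; apply/andP; split; lra.
have := pull_out_null sG GM iZ sgn_meas sgn_le Z0.
rewrite (@eq_Rintegral _ _ _ _ _ (fun w => `|Z w|)); last first.
  move=> w _; rewrite /sgn indicE; have [Zw|Zw] := ltP (Z w) 0.
    by rewrite mem_set // ltr0_norm // mulr1; ring.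
  rewrite memNset ?ger0_norm ?mulr0 ?subr0 ?mul1r //.
  by rewrite /N /=; apply/negP; rewrite -leNgt.
move=> zint; have := congr1 EFin zint; rewrite /Rintegral fineK; last first.
  by apply: integrable_fin_num => //; exact: integrable_norm.
have mZ : measurable_fun setT (EFin \o Z) by exact: measurable_int iZ.
move=> h; have [k _] := ae_eq_integral_abs P measurableT mZ.
have := k h; apply: filterS => w /= /(_ I) zw; exact: (EFin_inj zw).
Qed.

(** [cond_var_le] centres at some version m of the conditional mean. As 0 is another version, m = 0
    almost surely, and the variance is the second moment. *)
Lemma cond_second_moment_le Y (s : Omega -> R) : measurable_fun setT Y ->
  cond_exp_spec P G Y (fun=> 0) -> cond_var_le P G Y s ->
  exists2 v, cond_exp_spec P G (fun w => Y w ^+ 2) v & {ae P, forall w, v w <= s w}.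
Proof.
move=> mY [_ _ Y0] [m [[Gm im eqm] [v [vP vs]]]]; exists v => //.
have mm := Rmeas_measurable GM Gm.
apply: cond_exp_spec_ae vP.
- by apply: measurable_funX; exact: measurable_funB.
- exact: measurable_funX.
have m0 : {ae P, forall w, m w = 0}.
  apply: null_of_null_integrals => // A GA.
  rewrite /Rintegral -eqm // Y0 // integral0_eq //.
by apply: filterS m0 => w ->; rewrite subr0.
Qed.

(* The noise is bounded by [B] almost surely only; its clipped version is so everywhere. *)
Definition clip (B : R) Y w : R := \1_[set w | `|Y w| <= B] w * Y w.

Lemma clip_meas (B : R) Y : Rmeas_wrt G Y -> Rmeas_wrt G (clip B Y).
Proof.
move=> GY; apply: RmeasM => //; apply: Rmeas_indic => //.
have -> : [set w | `|Y w| <= B] = Y @^-1` `[- B, B].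
  by apply/seteqP; split => w /=; rewrite in_itv /= ler_norml.
exact: GY.
Qed.

Lemma clip_le (B : R) Y w : 0 <= B -> `|clip B Y w| <= B.
Proof.
move=> B0; rewrite /clip indicE; have [YB|YB] := leP `|Y w| B.
  by rewrite mem_set // mul1r.
by rewrite memNset ?mul0r ?normr0 //= ; apply/negP; rewrite -ltNge.
Qed.

Lemma clip_id (B : R) Y w : `|Y w| <= B -> clip B Y w = Y w.
Proof. by move=> YB; rewrite /clip indicE mem_set // mul1r. Qed.

Lemma ae_le_probability (A E : set Omega) : measurable A -> measurable E ->
  {ae P, forall w, A w -> E w} -> (P A <= P E)%E.
Proof.
move=> mA mE [N [mN PN sN]].
apply: (@le_trans _ _ (P (E `|` N))).
  apply: le_measure; rewrite ?inE //; first exact: measurableU.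
  move=> w Aw; have [Ew|nE] := pselect (E w); first by left.
  by right; apply: sN => /= h; apply: nE; exact: h.
apply: le_trans (measureU2 _ mE mN) _.
by rewrite [X in (_ + X)%E](_ : _ = 0%E) ?adde0.
Qed.

End ConditionalMoments.

(** * The tail bound and the deviation bound for the supremum *)

Section Bennett.
Context (R : realType) (H : completeNormedModType R) (ip : H -> H -> R).
Context (d : measure_display) (Omega : measurableType d) (P : probability Omega R).
Context (n : nat) (X : nat -> Omega -> H) (eps : nat -> Omega -> R).
Context (F : nat -> set (set Omega)) (sigma : nat -> Omega -> R) (B rho C : R).
Hypothesis ipP : inner_product ip.
Hypothesis sepH : separable H.
Hypothesis fF : filtration F.
Hypothesis hyp : forall t, (1 <= t <= n)%N ->
     [/\ Hmeas_wrt (F t.-1) (X t), Rmeas_wrt (F t) (eps t)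
       & cond_exp_spec P (F t.-1) (eps t) (fun _ => 0)] /\
     [/\ Rmeas_wrt (F t.-1) (sigma t),
         {ae P, forall w, `|eps t w| <= B} &
         cond_var_le P (F t.-1) (eps t) (fun w => sigma t w ^+ 2)].
Hypothesis B_gt0 : 0 < B.
Hypothesis rho_gt0 : 0 < rho.

Let A t w := gram_inv_sqrt ip (fun i => X i w) rho t.
Let M t w := lincomb X eps t w.
Hypothesis C_bound :
  {ae P, forall w, \sum_(1 <= i < n.+1) sigma i w ^+ 2 * `|A i w (X i w)| ^+ 2 <= C ^+ 2}.
Let Sup w : R := \big[Num.max/0]_(t < n.+1) `|A t w (M t w)|.

Let sF t : sigma_algebra setT (F t). Proof. by case: (fF t). Qed.
Let FM t : F t `<=` measurable. Proof. by case: (fF t). Qed.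

Let X_meas t : (t < n)%N -> Hmeas_wrt (F t) (X t.+1).
Proof. by move=> tn; have [[]] := hyp (tn : (1 <= t.+1 <= n)%N). Qed.

Let eps_meas t : (t < n)%N -> Rmeas_wrt (F t.+1) (eps t.+1).
Proof. by move=> tn; have [[]] := hyp (tn : (1 <= t.+1 <= n)%N). Qed.

Let ceps t := clip B (eps t).

Let ceps_meas t : (t < n)%N -> Rmeas_wrt (F t.+1) (ceps t.+1).
Proof. by move=> tn; apply: clip_meas => //; exact: eps_meas. Qed.

Let ceps_ae t : (t < n)%N -> {ae P, forall w, eps t.+1 w = ceps t.+1 w}.
Proof.
move=> tn; have [_ [_ le_B _]] := hyp (tn : (1 <= t.+1 <= n)%N).
by apply: filterS le_B => w eB; rewrite /ceps clip_id.
Qed.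

Let lincomb_ae : {ae P, forall w t, (t <= n)%N -> M t w = lincomb X ceps t w}.
Proof.
have h k : (k <= n)%N -> {ae P, forall w t, (t <= k)%N -> M t w = lincomb X ceps t w}.
  elim: k => [_|k IHk kn].
    by apply: nearW => w t; rewrite leqn0 => /eqP ->; rewrite /M !lincomb0.
  apply: filterS2 (IHk (ltnW kn)) (ceps_ae kn) => w hk hc t.
  rewrite leq_eqVlt => /orP[/eqP ->|/hk //].
  by rewrite /M !lincombS -hc -/(M k w) hk.
exact: h.
Qed.

Let norm_A t w : `|A t w (M t w)| = Num.sqrt (selfnorm ip X rho eps t w).
Proof.
by rewrite /selfnorm -(norm_gram_inv_sqrt _ ipP rho_gt0) sqrtr_sqr normr_id.
Qed.

Let norm_A_meas t : (t <= n)%N -> measurable_fun setT (fun w => `|A t w (M t w)|).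
Proof.
move=> tn; apply: (Rmeas_measurable (@FM t)).
rewrite (_ : (fun w => _) = fun w => Num.sqrt (selfnorm ip X rho eps t w)).
  by apply: Rmeas_sqrt; exact: (selfnorm_meas ipP sepH fF rho_gt0 X_meas eps_meas).
by apply/funext => w; exact: norm_A.
Qed.

Lemma Sup_measurable : measurable_fun setT Sup.
Proof.
rewrite /Sup; elim: (index_enum _) => [|i s IHs].
  by under eq_fun do rewrite big_nil; exact: measurable_cst.
under eq_fun do rewrite big_cons; apply: measurable_maxr => //.
by apply: norm_A_meas; rewrite -ltnS.
Qed.

Lemma Sup_ge_measurable r : measurable [set w | r <= Sup w].
Proof.
have -> : [set w | r <= Sup w] = Sup @^-1` `[r, +oo[.
  by apply/seteqP; split => w /=; rewrite in_itv /= andbT.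
by rewrite -[X in measurable X]setTI; exact: Sup_measurable.
Qed.

Lemma Sup_tail (lam r : R) : 0 < lam -> 0 < r ->
  cosh (lam * r) * fine (P [set w | r <= Sup w]) <=
  expR ((expR (lam * B) - 1 - lam * B) / B ^+ 2 * C ^+ 2).
Proof.
move=> lam_gt0 r_gt0.
pose N := selfnorm ip X rho ceps.
have N_meas t : (t <= n)%N -> Rmeas_wrt (F t) (N t).
  exact: (selfnorm_meas ipP sepH fF rho_gt0 X_meas ceps_meas).
have meps t : (t < n)%N -> measurable_fun setT (eps t.+1).
  by move=> tn; exact: (Rmeas_measurable (@FM t.+1) (eps_meas tn)).
have mceps t : (t < n)%N -> measurable_fun setT (ceps t.+1).
  by move=> tn; exact: (Rmeas_measurable (@FM t.+1) (ceps_meas tn)).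
apply: (le_trans _ (@self_normalized_tail _ _ _ P F n ceps sigma
  (gnorm ip X rho) (cross ip X rho ceps) (shrunk ip X rho ceps) N B C
  fF B_gt0 ceps_meas _ _ _ _ _ _ _ N_meas _ _ _ _ _ _ _ _ lam r lam_gt0 r_gt0)).
- have mE : measurable [set w | exists2 t, (t <= n)%N & r <= Num.sqrt (N t w)].
    have -> : [set w | exists2 t, (t <= n)%N & r <= Num.sqrt (N t w)] =
        \bigcup_(t in [set t | (t <= n)%N]) [set w | r <= Num.sqrt (N t w)].
      by apply/seteqP; split => w [t tn h]; exists t.
    apply: bigcup_measurable => t tn; apply: (@FM t).
    have -> : [set w | r <= Num.sqrt (N t w)] = (fun w => Num.sqrt (N t w)) @^-1` `[r, +oo[.
      by apply/seteqP; split => w /=; rewrite in_itv /= andbT.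
    by apply: Rmeas_sqrt (N_meas t tn) _ _.
  have mS := Sup_ge_measurable r.
  rewrite ler_wpM2l ?(ltW (cosh_gt0 _)) // fine_le ?fin_num_measure //.
  apply: ae_le_probability => //; apply: filterS lincomb_ae => w hw /= rS.
  (* As r > 0, the maximum cannot be its default value 0, so some index attains r. *)
  have [|[i _]] := bigmax_geP _ _ _ _ rS; first by move=> /(lt_le_trans r_gt0); rewrite ltxx.
  have i_n : (i <= n)%N by rewrite -ltnS.
  by rewrite norm_A => h; exists i => //; rewrite /N /selfnorm -hw.
- by move=> t w tn; apply: clip_le; exact: ltW.
- move=> t tn; have [[_ _ ce] _] := hyp (tn : (1 <= t.+1 <= n)%N).
  exact: (cond_exp_spec_ae (@FM t) (meps t tn) (mceps t tn) (ceps_ae tn) ce).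
- move=> t tn; have [[_ _ ce] [_ _ cv]] := hyp (tn : (1 <= t.+1 <= n)%N).
  have [v vP vs] := cond_second_moment_le (sF t) (@FM t) (meps t tn) ce cv.
  exists v => //; apply: cond_exp_spec_ae vP => //.
  - by apply: measurable_funX; exact: meps.
  - by apply: measurable_funX; exact: mceps.
  - by apply: filterS (ceps_ae tn) => w ->.
- by move=> t tn; have [_ []] := hyp (tn : (1 <= t.+1 <= n)%N).
- move=> t tn; exact: (gnorm_meas ipP sepH fF rho_gt0 X_meas tn).
- move=> t tn; exact: (cross_meas ipP sepH fF rho_gt0 X_meas ceps_meas tn).
- move=> t tn; exact: (shrunk_meas ipP sepH fF rho_gt0 X_meas ceps_meas tn).
- by move=> t w tn; rewrite /gnorm gram_inv_ge0 //= gram_inv_le1.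
- by move=> t w tn; rewrite /shrunk gram_inv_ge0.
- by move=> t w tn; rewrite /shrunk /N /selfnorm /= gram_inv_decr.
- by move=> t w; rewrite /N /selfnorm gram_inv_ge0.
- by move=> t w tn; rewrite /cross /shrunk /gnorm; exact: gram_inv_cauchy_schwarz.
- by move=> w; rewrite /N selfnorm0.
- by move=> t w tn; rewrite /N selfnormS.
- apply: filterS C_bound => w; congr (_ <= _).
  rewrite big_add1 big_mkord; apply: eq_bigr => i _; congr (_ * _).
  exact: (norm_gram_inv_sqrt _ ipP rho_gt0).
Qed.

Lemma Sup_bennett (r : R) : 0 <= r ->
  (P [set w | (r <= Sup w)%R] <=
    (2 * expR (- (C ^+ 2 / B ^+ 2) * hfun (B * r / C ^+ 2)))%:E)%E.
Proof.
move=> r0; have mS := Sup_ge_measurable r.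
have trivial_bound x : x = 0 -> (P [set w | (r <= Sup w)%R] <= (2 * expR x)%:E)%E.
  move=> ->; apply: le_trans (probability_le1 P mS) _.
  by rewrite expR0 lee_fin; lra.
have [rz|r_neq0] := eqVneq r 0.
  by apply: trivial_bound; rewrite rz mulr0 mul0r hfun0 mulr0.
have [C0|C_neq0] := eqVneq C 0.
  by apply: trivial_bound; rewrite C0 expr0n mul0r oppr0 mul0r.
have r_gt0 : 0 < r by rewrite lt_neqAle eq_sym r_neq0.
have C2 : 0 < C ^+ 2 by rewrite exprn_even_gt0.
(* Setting the derivative of phi C^2 - lam r in lam to zero gives e^(lam B) = 1 + B r / C^2; the
   minimum is the exponent - (C^2 / B^2) h(u). *)
pose u := B * r / C ^+ 2; pose l := ln (1 + u); pose lam := l / B.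
have u_gt0 : 0 < u by rewrite divr_gt0 // mulr_gt0.
have l_gt0 : 0 < l by rewrite ln_gt0 // ltrDl.
have lam_gt0 : 0 < lam by rewrite divr_gt0.
have lB : lam * B = l by rewrite divfK // gt_eqF.
have el : expR l = 1 + u by rewrite lnK // posrE addr_gt0.
have := Sup_tail lam_gt0 r_gt0; rewrite lB el => tail.
rewrite -[P _]fineK ?fin_num_measure // lee_fin.
have E : (1 + u - 1 - l) / B ^+ 2 * C ^+ 2 =
    - (C ^+ 2 / B ^+ 2) * hfun u + lam * r.
  have rE : r = u * C ^+ 2 / B by rewrite /u; field; rewrite C_neq0 gt_eqF.
  by rewrite /hfun -/l /lam rE; field; rewrite gt_eqF.
move: tail; rewrite E expRD => tail; have e_gt0 := expR_gt0 (lam * r).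
rewrite -(ler_pM2l e_gt0).
apply: (@le_trans _ _ (2 * (cosh (lam * r) * fine (P [set w | r <= Sup w])))).
  rewrite mulrA ler_wpM2r ?expR_le_cosh // fine_ge0 //.
by rewrite [leRHS]mulrCA ler_pM2l // [leRHS]mulrC.
Qed.

(** For C = 0 the radius in the deviation bound is 0, so the supremum must vanish almost surely.
    [Sup_tail] then reads cosh (lam r) P(Sup >= r) <= 1 for every lam > 0, and lam may be taken
    large. *)
Lemma Sup_null : C = 0 -> (P [set w | (0 < Sup w)%R] = 0)%E.
Proof.
move=> C0; have pos (r : R) : 0 < r -> P [set w | (r <= Sup w)%R] = 0%E.
  move=> r_gt0; have mS := Sup_ge_measurable r; set p := P _.
  have p_fin : p \is a fin_num by rewrite fin_num_measure.
  have p_ge0 : 0 <= fine p by apply: fine_ge0; exact: measure_ge0.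
  apply/eqP; rewrite -(fineK p_fin) eqe eq_le p_ge0 andbT leNgt; apply/negP => p_gt0.
  (* With lam r = k = 2 / p, the bound 2 cosh k >= e^k >= 1 + k gives p cosh k >= (p + 2) / 2 >
     1. *)
  have k_gt0 : 0 < 2 / fine p by rewrite divr_gt0.
  have := Sup_tail (divr_gt0 k_gt0 r_gt0) r_gt0.
  rewrite C0 expr0n mulr0 expR0 divfK ?gt_eqF // leNgt => /negP; apply.
  have := expR_le_cosh (2 / fine p); have := expR_ge1Dx (2 / fine p).
  have kp : 2 / fine p * fine p = 2 by rewrite divfK // gt_eqF.
  move: (2 / fine p) (cosh _) (expR _) kp => k c x kp h1 h2.
  have : 0 <= (2 * c - 1 - k) * fine p by rewrite mulr_ge0 //; lra.
  by lra.
have -> : [set w | 0 < Sup w] = \bigcup_k [set w | (k.+1%:R^-1 <= Sup w)%R].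
  apply/seteqP; split => w /=; last first.
    by move=> [k _ /=]; apply: lt_le_trans; rewrite invr_gt0.
  move=> S0; exists (Num.trunc (Sup w)^-1) => //=.
  by rewrite -[leRHS]invrK lef_pV2 ?posrE ?invr_gt0 // ltW // truncnS_gt.
apply: measure_negligible.
  by apply: bigcupT_measurable => k; exact: Sup_ge_measurable.
apply: negligible_bigcup => k; apply/negligibleP; first exact: Sup_ge_measurable.
by apply: pos; rewrite invr_gt0.
Qed.

Lemma Sup_deviation (delta : R) : 0 < delta < 1 ->
  ((1 - delta)%:E <=
   P [set w | (Sup w <= C ^+ 2 / B * hinv (B ^+ 2 / C ^+ 2 * ln (2 / delta)))%R])%E.
Proof.
move=> /andP[d0 d1]; set r := C ^+ 2 / B * _.
have setE : [set w | Sup w <= r] = ~` [set w | r < Sup w].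
  by apply/seteqP; split => w /=; rewrite leNgt => /negP.
have m_lt : measurable [set w | r < Sup w].
  have -> : [set w | r < Sup w] = Sup @^-1` `]r, +oo[.
    by apply/seteqP; split => w /=; rewrite in_itv /= andbT.
  by rewrite -[X in measurable X]setTI; exact: Sup_measurable.
suff : (P [set w | (r < Sup w)%R] <= delta%:E)%E.
  by rewrite setE probability_setC // EFinB => h; rewrite leeB.
have [C0|C_neq0] := eqVneq C 0.
  have -> : r = 0 by rewrite /r C0 expr0n !mul0r.
  by rewrite Sup_null // lee_fin ltW.
have C2 : 0 < C ^+ 2 by rewrite exprn_even_gt0.
have B2 : 0 < B ^+ 2 by rewrite exprn_gt0.
have l_ge0 : 0 <= ln (2 / delta).
  by rewrite ln_ge0 // ler_pdivlMr // mul1r; lra.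
have y_ge0 : 0 <= B ^+ 2 / C ^+ 2 * ln (2 / delta).
  by rewrite mulr_ge0 // divr_ge0 // ltW.
have [u_ge0 uE] := hinvP y_ge0.
have r_ge0 : 0 <= r by rewrite mulr_ge0 // divr_ge0 // ltW.
apply: (@le_trans _ _ (P [set w | (r <= Sup w)%R])).
  apply: le_measure; rewrite ?inE //; first exact: Sup_ge_measurable.
  by move=> w /=; exact: ltW.
(* By the choice of r, h(B r / C^2) = (B^2 / C^2) log (2 / delta), so the bound equals 2 (delta / 2)
   = delta. *)
apply: le_trans (Sup_bennett r_ge0) _; rewrite lee_fin.
have -> : B * r / C ^+ 2 = hinv (B ^+ 2 / C ^+ 2 * ln (2 / delta)).
  by rewrite /r; field; rewrite C_neq0 gt_eqF.
rewrite uE mulrA.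
have -> : - (C ^+ 2 / B ^+ 2) * (B ^+ 2 / C ^+ 2) = -1.
  by field; rewrite C_neq0 gt_eqF.
rewrite mulN1r expRN lnK ?posrE ?divr_gt0 //.
by rewrite invf_div mulrC divfK.
Qed.

End Bennett.

Theorem theorem3
  (R : realType) (H : completeNormedModType R) (ip : H -> H -> R)
  (d : measure_display) (Omega : measurableType d) (P : probability Omega R)
  (n : nat) (X : nat -> Omega -> H) (eps : nat -> Omega -> R)
  (F : nat -> set (set Omega)) (sigma : nat -> Omega -> R)
  (B rho C : R) :
  inner_product ip -> separable H ->
  (0 < n)%N ->
  filtration F ->
  (forall t, (1 <= t <= n)%N ->
     [/\ Hmeas_wrt (F t.-1) (X t), Rmeas_wrt (F t) (eps t)
       & cond_exp_spec P (F t.-1) (eps t) (fun _ => 0)] /\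
     [/\ Rmeas_wrt (F t.-1) (sigma t),
         {ae P, forall w, `|eps t w| <= B} &
         cond_var_le P (F t.-1) (eps t) (fun w => sigma t w ^+ 2)]) ->
  0 < B -> 0 < rho -> 0 <= C ->
  let V t w : H -> H := fun x => \sum_(1 <= i < t.+1) ip (X i w) x *: X i w in
  let M t w : H := \sum_(1 <= i < t.+1) eps i w *: X i w in
  let Ainv t w : H -> H := inv_sqrt ip (fun x => rho *: x + V t w x) in
  let G t w : H := Ainv t w (X t w) in
  {ae P, forall w, \sum_(1 <= i < n.+1) sigma i w ^+ 2 * `|G i w| ^+ 2 <= C ^+ 2} ->
  let Sup w : R := \big[Num.max/0]_(t < n.+1) `|Ainv t w (M t w)| in
  (forall delta : R, 0 < delta < 1 ->
     ((1 - delta)%:E <=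
      P [set w | (Sup w <= C ^+ 2 / B * hinv (B ^+ 2 / C ^+ 2 * ln (2 / delta)))%R])%E)
  /\
  (forall r : R, 0 <= r ->
     (P [set w | (Sup w >= r)%R] <=
      (2 * expR (- (C ^+ 2 / B ^+ 2) * hfun (B * r / C ^+ 2)))%:E)%E).
Proof.
move=> ipP sepH _ fF hyp B_gt0 rho_gt0 _ V M Ainv G C_bound Sup; split.
  exact: (Sup_deviation ipP sepH fF hyp B_gt0 rho_gt0 C_bound).
exact: (Sup_bennett ipP sepH fF hyp B_gt0 rho_gt0 C_bound).
Qed.
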